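(* Let $\mathfrak{C}$ be an abelian category, $(\mathcal{X},\omega)$ a Frobenius pair in $\mathfrak{C}$ and $m \in \mathbb{Z}_{\geq 0}$. The following assertions hold. (1) Suppose $(\mathcal{X},\omega)$ is induced by a hereditary and complete cotorsion pair $(\mathcal{X},\mathcal{X}^{\perp})$ in $\mathfrak{C}$ (that is, $\omega=\mathcal{X}\cap\mathcal{X}^\perp$). Then: (i) If $(\mathcal{X},\omega)$ is $\omega^\wedge_m$-complete in $\mathcal{X}^{\perp}$, then $(\mathcal{X}^\wedge_m,\ [\omega^\wedge_m]^{\perp_1}\cap\mathcal{X}^\perp)$ is a hereditary and complete cotorsion pair in $\mathfrak{C}$. Conversely, if $\mathcal{X}^\wedge_m$ is the left half of a hereditary and complete cotorsion pair in $\mathfrak{C}$, then $(\mathcal{X},\omega)$ is $\omega^\wedge_m$-complete in $\mathcal{X}^{\perp}$. (ii) Let $\mathcal{B}\subseteq\mathfrak{C}$ be a left thick class such that $\mathcal{X}^\wedge_m\subseteq\mathcal{B}\subseteq\mathcal{X}^\wedge$. If $(\mathcal{X},\omega)$ is $\omega^\wedge_m$-complete in $\mathcal{X}^\perp$, then $(\mathcal{X}^\wedge_m,\ [\omega^\wedge_m]^{\perp_1}\cap\mathcal{X}^\perp\cap\mathcal{B})$ is a hereditary and complete cotorsion pair in the weakly idempotent complete exact category $\mathcal{B}$. (2) If $(\mathcal{X},\omega)$ is $\omega^\wedge_m$-complete in $\mathcal{X}^{\perp_1}$, then $(\mathcal{X}^\wedge_m,\ [\omega^\wedge_m]^{\perp_1}\cap\mathcal{X}^{\perp_1})$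 is a cotorsion pair cut along $\mathcal{X}^\wedge$.
   Context: $A\rightarrowtail B\twoheadrightarrow C$ denotes a short exact sequence. $\mathrm{Ext}^i_{\mathfrak C}$ is the Yoneda Ext in the abelian category $\mathfrak C$ (enough projectives or injectives are not assumed). For a class $\mathcal{X}$: $\mathcal{X}^{\perp_i}=\{N: \mathrm{Ext}^i_{\mathfrak C}(X,N)=0\ \forall X\in\mathcal X\}$ for $i>0$, $\mathcal{X}^\perp=\bigcap_{i>0}\mathcal{X}^{\perp_i}$; ${}^{\perp_i}\mathcal{X}$, ${}^\perp\mathcal{X}$ are dual. $\mathcal{X}^\wedge_m$ is the class of objects $M$ having an exact sequence $0\to X_m\to\cdots\to X_0\to M\to 0$ with all $X_i\in\mathcal{X}$; $\mathcal{X}^\wedge=\bigcup_{m\ge 0}\mathcal{X}^\wedge_m$. A class is left thick if it is closed under extensions, kernels of epimorphisms between its objects, and direct summands. A (left) Frobenius pair $(\mathcal{X},\omega)$: (FP1) $\mathcal{X}$ is left thick; (FP2) $\omega$ is closed under direct summands; (FP3) $\mathrm{Ext}^i_{\mathfrak C}(X,W)=0$ for all $X\in\mathcal X$, $W\in\omega$, $i>0$; (FP4) $\omega\subseteq\mathcal X$ and every $X\in\mathcal X$ admits a short exact sequence $X\rightarrowtail W\twoheadrightarrow X'$ with $W\in\omega$, $X'\in\mathcal X$. A Frobenius pair $(\mathcal X,\omega)$ is $\omega^\wedge_m$-complete in $\mathcal{X}^{\perp_1}$ if for every $M\in\mathcal{X}^{\perp_1}$ there exist short exact sequences $K'\rightarrowtail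 L\twoheadrightarrow M$ and $M\rightarrowtail K\twoheadrightarrow L'$ with $L,L'\in\omega^\wedge_m$ and $K,K'\in[\omega^\wedge_m]^{\perp_1}$. (When $(\mathcal X,\mathcal X^\perp)$ is a hereditary cotorsion pair, $\mathcal X^{\perp_1}=\mathcal X^\perp$.) A cotorsion pair $(\mathcal A,\mathcal D)$ in $\mathfrak C$: $\mathcal A^{\perp_1}=\mathcal D$ and $\mathcal A={}^{\perp_1}\mathcal D$. It is complete if every $C\in\mathfrak C$ has short exact sequences $D\rightarrowtail A\twoheadrightarrow C$ and $C\rightarrowtail D'\twoheadrightarrow A'$ with $A,A'\in\mathcal A$, $D,D'\in\mathcal D$; hereditary if $\mathrm{Ext}^i_{\mathfrak C}(A,D)=0$ for all $A\in\mathcal A$, $D\in\mathcal D$, $i>0$. A left thick class $\mathcal B$ is regarded as an exact category with conflations the short exact sequences of $\mathfrak C$ with all terms in $\mathcal B$; it is weakly idempotent complete. Cotorsion pairs, completeness and hereditariness in $\mathcal B$ are defined in the same way, relative to this exact structure. $(\mathcal A,\mathcal D)$ is a cotorsion pair cut along a class $\mathcal S$ if: $\mathcal A$ and $\mathcal D$ are closed under direct summands; $\mathcal A\cap\mathcal S={}^{\perp_1}\mathcal D\cap\mathcal S$ and $\mathcal D\cap\mathcal S=\mathcal A^{\perp_1}\cap\mathcal S$; and for every $S\in\mathcal S$ there are short exact sequences $D\rightarrowtail A\twoheadrightarrow S$ and $S\rightarrowtail D'\twoheadrightarrow A'$ with $A,A'\in\mathcal A$, $D,D'\in\mathcal D$.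 *)

(* Defs.v *)
From HB Require Import structures.
From Stdlib Require Import Relation_Operators.
From mathcomp Require Import ssreflect ssrfun ssrbool ssrnat ssralg.
From mathcomp Require Import boolp classical_sets.

Set Implicit Arguments.
Unset Strict Implicit.
Unset Printing Implicit Defensive.

Import GRing.Theory.
Local Open Scope classical_set_scope.
Local Open Scope ring_scope.

Declare Scope cat_scope.
Delimit Scope cat_scope with cat.
Local Open Scope cat_scope.

HB.mixin Record isPreadditive C := {
  hom : C -> C -> zmodType;
  idm : forall A, hom A A;
  (* [comp A B D g f] is "g after f" *)
  comp : forall A B D, hom B D -> hom A B -> hom A D;
  comp_idl : forall A B (f : hom A B), comp _ _ _ (idm B) f = f;
  comp_idr : forall A B (f : hom A B), comp _ _ _ f (idm A) = f;
  compA : forall A B D E (h : hom D E) (g : hom B D) (f : hom A B),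
    comp _ _ _ h (comp _ _ _ g f) = comp _ _ _ (comp _ _ _ h g) f;
  compDl : forall A B D (g h : hom B D) (f : hom A B),
    comp _ _ _ (g + h) f = comp _ _ _ g f + comp _ _ _ h f;
  compDr : forall A B D (g : hom B D) (f h : hom A B),
    comp _ _ _ g (f + h) = comp _ _ _ g f + comp _ _ _ g h;
}.

#[short(type="preadditiveCategory")]
HB.structure Definition Preadditive := {C of isPreadditive C}.

Arguments idm {s} A : rename.
Arguments comp {s A B D} : rename.

Notation "g \o f" := (comp g f) : cat_scope.

Section PreadditiveNotions.
Variable C : preadditiveCategory.
Implicit Types A B D K P Z : C.

Definition mono A B (f : hom A B) : Prop :=
  forall Z (g h : hom Z A), f \o g = f \o h -> g = h.

Definition epi A B (f : hom A B) : Prop :=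
  forall Z (g h : hom B Z), g \o f = h \o f -> g = h.

Definition is_kernel K A B (k : hom K A) (f : hom A B) : Prop :=
  f \o k = 0 /\
  forall Z (g : hom Z A), f \o g = 0 -> exists! u : hom Z K, k \o u = g.

Definition is_cokernel A B K (c : hom B K) (f : hom A B) : Prop :=
  c \o f = 0 /\
  forall Z (g : hom B Z), g \o f = 0 -> exists! u : hom K Z, u \o c = g.

Definition is_zero Z : Prop :=
  (forall A (f : hom A Z), f = 0) /\ (forall A (f : hom Z A), f = 0).

Definition is_biproduct P A B : Prop :=
  exists (i1 : hom A P) (i2 : hom B P) (p1 : hom P A) (p2 : hom P B),
    [/\ p1 \o i1 = idm A, p2 \o i2 = idm B, p1 \o i2 = 0, p2 \o i1 = 0
      & (i1 \o p1) + (i2 \o p2) = idm P].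

End PreadditiveNotions.

HB.mixin Record isAbelian C of Preadditive C := {
  ex_zero : exists Z : C, is_zero Z;
  ex_biproduct : forall A B : C, exists P : C, is_biproduct P A B;
  ex_kernel : forall (A B : C) (f : hom A B),
    exists (K : C) (k : hom K A), is_kernel k f;
  ex_cokernel : forall (A B : C) (f : hom A B),
    exists (K : C) (c : hom B K), is_cokernel c f;
  mono_normal : forall (A B : C) (f : hom A B), mono f ->
    exists (D : C) (g : hom B D), is_kernel f g;
  epi_normal : forall (A B : C) (f : hom A B), epi f ->
    exists (D : C) (g : hom D A), is_cokernel f g;
}.

#[short(type="abelianCategory")]
HB.structure Definition Abelian := {C of isAbelian C & Preadditive C}.

Section AbelianNotions.
Variable C : abelianCategory.
Implicit Types (A B D E K L M N : C) (S X Y W F G : set C).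

(* Exactness at [B]: [f] corestricts to an epimorphism onto the kernel of [g]. *)
Definition exact_at A B D (f : hom A B) (g : hom B D) : Prop :=
  exists (K : C) (k : hom K B) (e : hom A K),
    [/\ is_kernel k g, epi e & f = k \o e].

Definition short_exact A B D (i : hom A B) (p : hom B D) : Prop :=
  is_kernel i p /\ is_cokernel p i.

(* A class [S] of objects carries the exact structure whose conflations are the
   short exact sequences with all three terms in [S]; [S = setT] gives the
   ambient abelian category.  Every notion below that takes [S] as its first
   argument is relative to this exact structure. *)
Definition conflation S A B D (i : hom A B) (p : hom B D) : Prop :=
  short_exact i p /\ [/\ S A, S B & S D].

Definition conflating S A B D : Prop :=
  exists (i : hom A B) (p : hom B D), conflation S i p.

Record extension S M N := Extension {
  ext_mid : C;
  ext_in : hom N ext_mid;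
  ext_out : hom ext_mid M;
  ext_conflation : conflation S ext_in ext_out
}.

(* Degree 0: morphisms [M -> N]; degree 1: conflations from [N] to [M]; degree
   [n + 1]: a conflation [K >-> E ->> M] spliced with an [n]-extension of [K]
   by [N], i.e. an exact sequence from [N] to [M] with [n + 1] middle terms
   which is a splice of conflations. *)
Fixpoint yext S (n : nat) M N : Type :=
  match n with
  | 0 => hom M N
  | n'.+1 => match n' with
             | 0 => extension S M N
             | _.+1 => {K : C & (extension S M K * yext S n' K N)%type}
             end
  end.

Definition extension_mor S M M' N N' (f : hom M M') (g : hom N N')
    (x : extension S M N) (x' : extension S M' N') : Prop :=
  exists u : hom (ext_mid x) (ext_mid x'),
    u \o ext_in x = ext_in x' \o g /\ ext_out x' \o u = f \o ext_out x.

(* There is a morphism of exact sequences from [x] to [x'] with outer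
   components [f] and [g]. *)
Fixpoint yext_mor S (n : nat) M M' N N' (f : hom M M') (g : hom N N') :
    yext S n M N -> yext S n M' N' -> Prop :=
  match n with
  | 0 => fun x x' => g \o x = x' \o f
  | n'.+1 =>
    match n' as n1
      return (forall K K' : C, hom K K' ->
                yext S n1 K N -> yext S n1 K' N' -> Prop) ->
             yext S n1.+1 M N -> yext S n1.+1 M' N' -> Prop
    with
    | 0 => fun _ => extension_mor f g
    | _.+1 => fun mor x x' =>
        exists k : hom (projT1 x) (projT1 x'),
          extension_mor f k (projT2 x).1 (projT2 x').1 /\
          mor _ _ k (projT2 x).2 (projT2 x').2
    end (fun K K' k => @yext_mor S n' K K' N N' k g)
  end.

Definition yoneda_equiv S n M N : yext S n M N -> yext S n M N -> Prop :=
  clos_refl_sym_trans _ (fun x x' => yext_mor (idm M) (idm N) x x').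

(* The underlying set of the Yoneda Ext group: equivalence classes for the
   equivalence relation generated by morphisms fixing both ends. *)
Definition Ext S (n : nat) M N : set (set (yext S n M N)) :=
  range (fun x => [set x' | yoneda_equiv x x']).

(* A group is zero when it has no two distinct elements. *)
Definition Ext_vanishes S (n : nat) M N : Prop := is_subset1 (@Ext S n M N).

Definition rperp_i S (i : nat) X : set C :=
  [set N | S N /\ forall M, X M -> Ext_vanishes S i M N].

Definition lperp_i S (i : nat) X : set C :=
  [set M | S M /\ forall N, X N -> Ext_vanishes S i M N].

Definition rperp S X : set C := \bigcap_(i in [set i | (0 < i)%N]) rperp_i S i X.

(* The sequence [0 -> P m -> ... -> P 0 -> M -> 0], continued by zero objects. *)
Definition resolved X (m : nat) : set C :=
  [set M | exists (P : nat -> C) (d : forall i, hom (P i.+1) (P i))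
             (e : hom (P 0%N) M),
     [/\ forall i, (i <= m)%N -> X (P i),
         forall i, (m < i)%N -> is_zero (P i),
         epi e,
         exact_at (d 0%N) e
       & forall i, exact_at (d i.+1) (d i)]].

Definition finitely_resolved X : set C := \bigcup_m resolved X m.

Definition closed_ext X : Prop :=
  forall A B D, conflating setT A B D -> X A -> X D -> X B.

Definition closed_ker_epi X : Prop :=
  forall A B D, conflating setT A B D -> X B -> X D -> X A.

Definition closed_summand X : Prop :=
  forall A A' B, is_biproduct B A A' -> X B -> X A.

Definition left_thick X : Prop :=
  [/\ closed_ext X, closed_ker_epi X & closed_summand X].

Definition frobenius_pair X W : Prop :=
  [/\ left_thick X,
      closed_summand W,
      forall i A B, (0 < i)%N -> X A -> W B -> Ext_vanishes setT i A B,
      W `<=` X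
    & forall A, X A -> exists B D, [/\ conflating setT A B D, W B & X D]].

(* [(X, W)] is [W^_m]-complete in [Y], where [Y] is the right orthogonal class
   of [X] under consideration. *)
Definition wedge_complete_in W (m : nat) Y : Prop :=
  forall M, Y M ->
    (exists K' L, [/\ conflating setT K' L M,
       resolved W m L & rperp_i setT 1 (resolved W m) K']) /\
    (exists K L', [/\ conflating setT M K L',
       resolved W m L' & rperp_i setT 1 (resolved W m) K]).

Definition has_approximations S F G M : Prop :=
  (exists D A, [/\ conflating S D A M, F A & G D]) /\
  (exists D A, [/\ conflating S M D A, F A & G D]).

Definition cotorsion_pair S F G : Prop :=
  rperp_i S 1 F = G /\ F = lperp_i S 1 G.

Definition complete_pair S F G : Prop :=
  forall M, S M -> has_approximations S F G M.

Definition hereditary_pair S F G : Prop :=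
  forall i A D, (0 < i)%N -> F A -> G D -> Ext_vanishes S i A D.

Definition hereditary_complete_cotorsion_pair S F G : Prop :=
  [/\ cotorsion_pair S F G, hereditary_pair S F G & complete_pair S F G].

Definition cotorsion_pair_cut_along F G S : Prop :=
  [/\ closed_summand F, closed_summand G,
      F `&` S = lperp_i setT 1 G `&` S,
      G `&` S = rperp_i setT 1 F `&` S
    & forall M, S M -> has_approximations setT F G M].

End AbelianNotions.

(* Main.v *)
(* Yoneda Ext is handled without enough projectives or injectives.  Call an
   exact sequence left split when its leftmost monomorphism splits.  An extension
   is equivalent to zero iff a left-split one maps to it with both ends fixed;
   this rests on completing cospans of extensions to spans.  It yields the piece
   Ext^n(A,V) -> Ext^n(A,N) -> Ext^{n+1}(A,K) of the long exact sequence, hence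
   Ext^n(X,W^) = 0 for n > 0.

   Pushing out gives, for M in X^_m, sequences K >-> P ->> M and M >-> H ->> D
   with P, D in X, K in W^_{m-1} and H in W^_m.  Every N in the right-hand class
   G is Ext^1-orthogonal to X^_m: an extension of M by N comes from a map
   K -> N, and this map extends along K >-> P >-> V with V in W, because V/K lies
   in W^_m.  Given approximations of M by X and its right orthogonal class,
   composing them with N >-> K' ->> L (N in the orthogonal class, L in W^_m)
   yields approximations by X^_m and G.  Closure of X^_m under direct summands
   follows by splitting off syzygies, and hereditariness by dimension shifting
   along epimorphisms from X. *)
From HB Require Import structures.
From Stdlib Require Import Relation_Operators.
From mathcomp Require Import ssreflect ssrfun ssrbool ssrnat ssralg.
From mathcomp Require Import boolp classical_sets.
Require Import Defs.

Set Implicit Arguments.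
Unset Strict Implicit.
Unset Printing Implicit Defensive.

Import GRing.Theory.
Local Open Scope classical_set_scope.

#[local] Arguments compA {s A B D E} h g f : rename.
#[local] Arguments comp_idl {s A B} f : rename.
#[local] Arguments comp_idr {s A B} f : rename.

(** * Bilinear composition, monomorphisms, epimorphisms, kernels and pullbacks *)

Section Pre.
Local Open Scope ring_scope.
Local Open Scope cat_scope.
Variable C : preadditiveCategory.
Implicit Types A B D K P Z : C.

Lemma comp0l A B D (f : hom A B) : (0 : hom B D) \o f = 0.
Proof. by apply: (addIr (0 \o f)); rewrite -compDl !add0r. Qed.

Lemma comp0r A B D (g : hom B D) : g \o (0 : hom A B) = 0.
Proof. by apply: (addIr (g \o 0)); rewrite -compDr !add0r. Qed.

Lemma compNl A B D (g : hom B D) (f : hom A B) : (- g) \o f = - (g \o f).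
Proof. by apply: (addIr (g \o f)); rewrite -compDl !addNr comp0l. Qed.

Lemma compNr A B D (g : hom B D) (f : hom A B) : g \o (- f) = - (g \o f).
Proof. by apply: (addIr (g \o f)); rewrite -compDr !addNr comp0r. Qed.

Lemma compBl A B D (g h : hom B D) (f : hom A B) :
  (g - h) \o f = (g \o f) - (h \o f).
Proof. by rewrite compDl compNl. Qed.

Lemma compBr A B D (g : hom B D) (f h : hom A B) :
  g \o (f - h) = (g \o f) - (g \o h).
Proof. by rewrite compDr compNr. Qed.

Lemma epi_eq0 A B Z (f : hom A B) (g : hom B Z) :
  epi f -> g \o f = 0 -> g = 0.
Proof. by move=> ef gf; apply: ef; rewrite gf comp0l. Qed.

Lemma mono_eq0 A B Z (f : hom A B) (g : hom Z A) :
  mono f -> f \o g = 0 -> g = 0.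
Proof. by move=> mf fg; apply: mf; rewrite fg comp0r. Qed.

Lemma mono0P A B (f : hom A B) :
  mono f <-> forall Z (g : hom Z A), f \o g = 0 -> g = 0.
Proof.
split=> [mf Z g fg|f0 Z g h fgh]; first by apply: mf; rewrite fg comp0r.
by apply/subr0_eq/f0; rewrite compBr fgh subrr.
Qed.

Lemma epi0P A B (f : hom A B) :
  epi f <-> forall Z (g : hom B Z), g \o f = 0 -> g = 0.
Proof.
split=> [ef Z g fg|f0 Z g h fgh]; first by apply: ef; rewrite fg comp0l.
by apply/subr0_eq/f0; rewrite compBl fgh subrr.
Qed.

Lemma kernel_mono K A B (k : hom K A) (f : hom A B) : is_kernel k f -> mono k.
Proof.
move=> [fk kP]; apply/mono0P => Z g kg.
have [//|u [_ uu]] := kP Z 0 _; first by rewrite comp0r.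
by rewrite -(uu g kg); apply: uu; rewrite comp0r.
Qed.

Lemma epi_comp A B D (g : hom B D) (f : hom A B) :
  epi f -> epi g -> epi (g \o f).
Proof. by move=> ef eg Z h k; rewrite !compA => /ef/eg. Qed.

Lemma kernelP K A B (k : hom K A) (f : hom A B) :
  is_kernel k f <-> [/\ f \o k = 0, mono k &
    forall Z (g : hom Z A), f \o g = 0 -> exists u : hom Z K, k \o u = g].
Proof.
split=> [kf|[fk mk kP]].
  split; [by case: kf|exact: kernel_mono kf|].
  by case: kf => _ kP Z g /kP[u [<- _]]; exists u.
split=> // Z g /kP[u <-]; by exists u; split=> // v kv; apply: mk; rewrite kv.
Qed.

(** Existence and uniqueness of the factorization are kept apart, uniqueness being joint monicity of
    [a] and [b], so that each can be used alone. *)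
Definition pullback P A B D (a : hom P A) (b : hom P B) (f : hom A D)
    (g : hom B D) : Prop :=
  [/\ f \o a = g \o b,
      forall Z (u : hom Z A) (v : hom Z B), f \o u = g \o v ->
        exists w : hom Z P, a \o w = u /\ b \o w = v
    & forall Z (w w' : hom Z P),
        a \o w = a \o w' -> b \o w = b \o w' -> w = w'].

Lemma pullbackC P A B D (a : hom P A) (b : hom P B) (f : hom A D)
  (g : hom B D) : pullback a b f g -> pullback b a g f.
Proof.
move=> [fagb exw un]; split=> // [Z u v /esym/exw[w [au bv]]|Z w w' bw aw].
  by exists w.
exact: un.
Qed.

Definition pushout P A B D (a : hom A P) (b : hom B P) (f : hom D A)
    (g : hom D B) : Prop :=
  [/\ a \o f = b \o g,
      forall Z (u : hom A Z) (v : hom B Z), u \o f = v \o g ->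
        exists w : hom P Z, w \o a = u /\ w \o b = v
    & forall Z (w w' : hom P Z),
        w \o a = w' \o a -> w \o b = w' \o b -> w = w'].

Lemma pullback_kernel N P A B D (i : hom N A) (f : hom A D) (g : hom B D)
    (a : hom P A) (b : hom P B) :
  is_kernel i f -> pullback a b f g ->
  exists i' : hom N P, is_kernel i' b /\ a \o i' = i.
Proof.
move=> /kernelP[fi mi iP] [fagb exw un].
have [i' [ai' bi']] : exists w : hom N P, a \o w = i /\ b \o w = 0.
  by apply: exw; rewrite fi comp0r.
exists i'; split=> //; apply/kernelP; split=> //.
  by move=> Z u v /(congr1 (comp a)); rewrite !compA ai' => /mi.
move=> Z u bu; have [v iv] : exists v, i \o v = a \o u.
  by apply: iP; rewrite compA fagb -compA bu comp0r.
exists v; apply: un; first by rewrite compA ai'.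
by rewrite compA bi' comp0l bu.
Qed.

End Pre.

(** * The opposite category, on an alias of the type so that both structures coexist *)

Definition opposite (T : Type) : Type := T.

Section Opp.
Local Open Scope ring_scope.
Local Open Scope cat_scope.
Variable C : preadditiveCategory.
Definition op_hom (A B : opposite C) : zmodType := hom (B : C) (A : C).
Definition op_comp (A B D : opposite C) (g : op_hom B D) (f : op_hom A B) :
  op_hom A D := (f : hom (B : C) (A : C)) \o (g : hom (D : C) (B : C)).
HB.instance Definition _ := isPreadditive.Build (opposite C)
  (hom := op_hom) (idm := fun A => idm (A : C)) (comp := op_comp)
  (fun A B f => @comp_idr C B A f) (fun A B f => @comp_idl C B A f)
  (fun A B D E h g f => esym (compA f g h))
  (fun A B D g h f => @compDr C D B A f g h)
  (fun A B D g f h => @compDl C D B A f h g).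
End Opp.

Lemma op_biproduct (C : preadditiveCategory) (P A B : C) :
  is_biproduct P A B -> is_biproduct (C := opposite C) P A B.
Proof. by move=> [i [j [p [q [? ? ? ? ?]]]]]; exists p, q, i, j. Qed.

Lemma op_zero (C : preadditiveCategory) (Z : C) :
  is_zero Z -> is_zero (C := opposite C) Z.
Proof. by case. Qed.

Section OppAb.
Variable C : abelianCategory.
Lemma op_ex_zero : exists Z : opposite C, is_zero Z.
Proof. by have [Z /op_zero] := @ex_zero C; exists Z. Qed.
Lemma op_ex_biproduct (A B : opposite C) :
  exists P : opposite C, is_biproduct P A B.
Proof. by have [P /op_biproduct] := @ex_biproduct C A B; exists P. Qed.
HB.instance Definition _ := isAbelian.Build (opposite C)
  op_ex_zero op_ex_biproduct
  (fun A B f => @ex_cokernel C B A f) (fun A B f => @ex_kernel C B A f)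
  (fun A B f => @epi_normal C B A f) (fun A B f => @mono_normal C B A f).
End OppAb.

(** * Short exact sequences, pullbacks and biproducts in an abelian category *)

Section Ab.
Local Open Scope ring_scope.
Local Open Scope cat_scope.
Local Open Scope classical_set_scope.
Variable C : abelianCategory.
Implicit Types A B D K P Z N M E : C.

(** By normality [f] is the cokernel of some [g]; as [g] factors through [k], every map that kills
    [k] kills [g]. *)
Lemma epi_cokernel K A B (k : hom K A) (f : hom A B) :
  is_kernel k f -> epi f -> is_cokernel f k.
Proof.
move=> [fk kP] ef; split=> // Z h hk.
have [D [g [fg fP]]] := epi_normal _ _ _ ef.
have [u [ku _]] := kP _ _ fg.
by apply: fP; rewrite -ku compA hk comp0l.
Qed.

Lemma short_exact_epi K A B (k : hom K A) (f : hom A B) :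
  is_kernel k f -> epi f -> short_exact k f.
Proof. by move=> kf ef; split=> //; apply: epi_cokernel. Qed.

Lemma ex_short_exact_epi A B (f : hom A B) :
  epi f -> exists K (k : hom K A), short_exact k f.
Proof.
move=> ef; have [K [k kf]] := ex_kernel _ _ f.
by exists K, k; apply: short_exact_epi.
Qed.

Lemma short_exact_op A B D (i : hom A B) (p : hom B D) :
  short_exact i p <-> @short_exact (opposite C) D B A p i.
Proof. by split=> -[]. Qed.

(** The pullback is the kernel of the difference of [f \o p1] and [g \o p2] on the biproduct. *)
Lemma ex_pullback A B D (f : hom A D) (g : hom B D) :
  exists P (a : hom P A) (b : hom P B), pullback a b f g.
Proof.
have [Q [i1 [i2 [p1 [p2 [p1i1 p2i2 p1i2 p2i1 ip]]]]]] := ex_biproduct A B.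
have [P [k /kernelP[fk mk kP]]] := ex_kernel _ _ ((f \o p1) - (g \o p2)).
exists P, (p1 \o k), (p2 \o k); split.
- by apply/subr0_eq; rewrite !compA -compBl.
- move=> Z u v fugv; have [|w kw] := kP Z ((i1 \o u) + (i2 \o v)).
    rewrite compBl !compDr -!compA !(compA p1) !(compA p2) p1i1 p2i2 p1i2 p2i1.
    by rewrite !comp0l !comp_idl !comp0r addr0 add0r fugv subrr.
  exists w; rewrite -!compA kw !compDr !compA p1i1 p2i2 p1i2 p2i1.
  by rewrite !comp0l !comp_idl addr0 add0r.
move=> Z w w' e1 e2; apply: mk.
rewrite -[k \o w]comp_idl -[k \o w']comp_idl -ip !compDl -!compA.
by rewrite (compA p1) (compA p2) e1 e2 !compA.
Qed.

Lemma cokernel_epi A B D (f : hom A B) (c : hom B D) : is_cokernel c f -> epi c.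
Proof. by move=> cf; apply: (@kernel_mono (opposite C) _ _ _ c f). Qed.

(** The difference [h] on the biproduct is epi because [f] is, hence it is the cokernel of its
    kernel. If [z] kills [b], then [z \o p2] kills that kernel and factors through [h]; restricting
    to [A] shows that the factor vanishes. *)
Lemma pullback_epi P A B D (a : hom P A) (b : hom P B) (f : hom A D)
  (g : hom B D) : pullback a b f g -> epi f -> epi b.
Proof.
move=> [fagb exw un] ef; apply/epi0P => Z z zb.
have [Q [i1 [i2 [p1 [p2 [p1i1 p2i2 p1i2 p2i1 ip]]]]]] := ex_biproduct A B.
set h := (f \o p1) - (g \o p2).
have hi1 : h \o i1 = f.
  by rewrite compBl -!compA p1i1 p2i1 comp0r comp_idr subr0.
have eh : epi h.
  by apply/epi0P => Y y yh; apply: (epi_eq0 ef); rewrite -hi1 compA yh comp0l.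
have [K [k kh]] := ex_kernel _ _ h.
have [_ hc] := epi_cokernel kh eh.
have [|w [aw bw]] := exw _ (p1 \o k) (p2 \o k).
  by apply/subr0_eq; rewrite !compA -compBl; case: kh.
have [|u [uh _]] := hc _ (z \o p2).
  by rewrite -compA -bw compA zb comp0l.
have u0 : u = 0.
  by apply: (epi_eq0 ef); rewrite -hi1 compA uh -compA p2i1 comp0r.
by rewrite -[z]comp_idr -p2i2 compA -uh u0 !comp0l.
Qed.

Lemma pullback_short_exact P N A B D (i : hom N A) (f : hom A D) (g : hom B D)
    (a : hom P A) (b : hom P B) :
  short_exact i f -> pullback a b f g ->
  exists i' : hom N P, short_exact i' b /\ a \o i' = i.
Proof.
move=> [ki cf] pb; have [i' [ki' ai']] := pullback_kernel ki pb.
exists i'; split=> //; apply: short_exact_epi => //.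
exact: pullback_epi pb (cokernel_epi cf).
Qed.

Lemma short_exact_lift A B D Z (i : hom A B) (p : hom B D) (g : hom Z B) :
  short_exact i p -> p \o g = 0 -> exists u : hom Z A, i \o u = g.
Proof. by move=> [/kernelP[_ _ iP] _]; apply: iP. Qed.

Lemma short_exact_mono A B D (i : hom A B) (p : hom B D) :
  short_exact i p -> mono i.
Proof. by move=> [/kernel_mono]. Qed.

Lemma short_exact_comp0 A B D (i : hom A B) (p : hom B D) :
  short_exact i p -> p \o i = 0.
Proof. by move=> [[]]. Qed.

Lemma conflatingT A B D :
  conflating setT A B D <-> exists (i : hom A B) (p : hom B D), short_exact i p.
Proof.
by split=> [[i [p [ip _]]]|[i [p ip]]]; exists i, p; last split.
Qed.

Lemma section_biproduct A B D (i : hom A B) (p : hom B D) (s : hom D B) :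
  short_exact i p -> p \o s = idm D ->
  exists r : hom B A,
    [/\ r \o i = idm A, r \o s = 0 & (i \o r) + (s \o p) = idm B].
Proof.
move=> ip ps; have [|r ir] := short_exact_lift (g := idm B - (s \o p)) ip.
  by rewrite compBr comp_idr compA ps comp_idl subrr.
have mi := short_exact_mono ip.
exists r; split; last by rewrite ir subrK.
  apply: mi; rewrite compA ir compBl comp_idl comp_idr -compA.
  by rewrite (short_exact_comp0 ip) comp0r subr0.
apply: (mono_eq0 mi).
by rewrite compA ir compBl -compA ps comp_idl comp_idr subrr.
Qed.

Lemma biproduct_short_exact P A B (i1 : hom A P) (i2 : hom B P) (p1 : hom P A)
    (p2 : hom P B) :
  p1 \o i1 = idm A -> p2 \o i2 = idm B -> p2 \o i1 = 0 ->
  (i1 \o p1) + (i2 \o p2) = idm P -> short_exact i1 p2.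
Proof.
move=> p1i1 p2i2 p2i1 ip; apply: short_exact_epi; last first.
  by move=> Z g h e; rewrite -[g]comp_idr -[h]comp_idr -p2i2 !compA e.
apply/kernelP; split=> // [Z g h e|Z g p2g].
  by rewrite -[g]comp_idl -[h]comp_idl -p1i1 -!compA e.
exists (p1 \o g); rewrite -[RHS]comp_idl -ip compDl -(compA i2) p2g comp0r.
by rewrite addr0 compA.
Qed.

Lemma biproduct_conflating P A B : is_biproduct P A B -> conflating setT A P B.
Proof.
move=> [i1 [i2 [p1 [p2 [p1i1 p2i2 _ p2i1 ip]]]]].
by apply/conflatingT; exists i1, p2; apply: biproduct_short_exact ip.
Qed.

Lemma from_zero_eq Z A (f g : hom Z A) : is_zero Z -> f = g.
Proof. by move=> [_ Z0]; rewrite (Z0 _ f) (Z0 _ g). Qed.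

Lemma to_zero_eq Z A (f g : hom A Z) : is_zero Z -> f = g.
Proof. by move=> [Z0 _]; rewrite (Z0 _ f) (Z0 _ g). Qed.

Lemma zero_short_exact Z M : is_zero Z -> short_exact (0 : hom Z M) (idm M).
Proof.
move=> Z0; apply: short_exact_epi.
  apply/kernelP; split; first by rewrite comp0r.
    by move=> Y g h _; apply: to_zero_eq.
  by move=> Y g; rewrite comp_idl => ->; exists 0; rewrite comp0l.
by move=> Y g h; rewrite !comp_idr.
Qed.

Lemma conflating_pullback A Q M K X :
  conflating setT A Q M -> conflating setT K X M ->
  exists P, conflating setT A P X /\ conflating setT K P Q.
Proof.
move=> /conflatingT[i [p ip]] /conflatingT[j [q jq]].
have [P [a [b pb]]] := ex_pullback p q.
exists P; split; apply/conflatingT.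
  by have [i' []] := pullback_short_exact ip pb; exists i', b.
by have [j' []] := pullback_short_exact jq (pullbackC pb); exists j', a.
Qed.

(** The kernel of the composite is the preimage of [N] in [X], obtained as a pullback. *)
Lemma conflating_comp_epi K X P N M :
  conflating setT K X P -> conflating setT N P M ->
  exists Q, conflating setT Q X M /\ conflating setT K Q N.
Proof.
move=> /conflatingT[k [f kf]] /conflatingT[l [g lg]].
have [Q [a [b pb]]] := ex_pullback f l.
have [k' [k'b ak']] := pullback_short_exact kf pb.
exists Q; split; apply/conflatingT; last by exists k', b.
exists a, (g \o f); apply: short_exact_epi; last first.
  by apply: epi_comp; [case: kf|case: lg] => _ /cokernel_epi.
case: pb => falb exw un; apply/kernelP; split.
- by rewrite -compA falb compA (short_exact_comp0 lg) comp0l.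
- move=> Z u v auv; apply: un => //; apply: (short_exact_mono lg).
  by rewrite !compA -falb -!compA auv.
- move=> Z u gfu; have [|v lv] := short_exact_lift (g := f \o u) lg.
    by rewrite compA.
  by have [w [aw _]] := exw _ u v (esym lv); exists w.
Qed.

(* A morphism of extensions that is the identity on the left end exhibits its
   source as a pullback of its target. *)
Lemma extension_mor_pullback N M M' E E' (i : hom N E) (p : hom E M)
    (i' : hom N E') (p' : hom E' M') (u : hom E E') (f : hom M M') :
  short_exact i p -> short_exact i' p' -> u \o i = i' -> p' \o u = f \o p ->
  pullback u p p' f.
Proof.
move=> ip ip' ui p'u.
have zero Z (w : hom Z E) : u \o w = 0 -> p \o w = 0 -> w = 0.
  move=> uw pw; have [n nw] := short_exact_lift ip pw.
  rewrite -nw (mono_eq0 (short_exact_mono ip') (g := n)) ?comp0r //.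
  by rewrite -ui -compA nw.
split=> // [Z w v p'w|Z w w' uw pw]; last first.
  by apply/subr0_eq/zero; rewrite compBr ?uw ?pw subrr.
(* To factor [w] and [v] through [E], pass to the epimorphic cover [z], on which [v] lifts along
   [p]. The lift is corrected by a map into [N] and then descends along [z]. *)
have [Z' [t [z pb]]] := ex_pullback p v.
have ez : epi z by apply: (pullback_epi pb); case: ip => _ /cokernel_epi.
have [ptvz _ _] := pb.
have [|n i'n] := short_exact_lift (g := (w \o z) - (u \o t)) ip'.
  by rewrite compBr !compA p'w p'u -!compA ptvz subrr.
have [k [kp kz]] := ex_short_exact_epi ez.
set t' := t + (i \o n).
have ut' : u \o t' = w \o z by rewrite compDr compA ui i'n addrC subrK.
have pt' : p \o t' = v \o z.
  by rewrite compDr compA (short_exact_comp0 ip) comp0l addr0.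
have [|s [sz _]] := kz.2.2 _ t'.
  apply: zero; first by rewrite compA ut' -compA (short_exact_comp0 kz) comp0r.
  by rewrite compA pt' -compA (short_exact_comp0 kz) comp0r.
by exists s; split; apply: ez; rewrite -compA sz //.
Qed.

(** The biproducts of the middle and right terms are prescribed, so that an object with a given
    decomposition can serve as right term when syzygies are split off. *)
Lemma conflating_biproduct A B D A' B' D' P Q :
  conflating setT A B D -> conflating setT A' B' D' ->
  is_biproduct P B B' -> is_biproduct Q D D' ->
  exists N, conflating setT N P Q /\ is_biproduct N A A'.
Proof.
move=> /conflatingT[k [f kf]] /conflatingT[k' [f' kf']].
move=> [i1 [i2 [p1 [p2 [p1i1 p2i2 p1i2 p2i1 ip]]]]].
move=> [j1 [j2 [q1 [q2 [q1j1 q2j2 q1j2 q2j1 jq]]]]].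
have [N [a1 [a2 [b1 [b2 [b1a1 b2a2 b1a2 b2a1 ab]]]]]] := ex_biproduct A A'.
exists N; split; last by exists a1, a2, b1, b2.
apply/conflatingT.
exists ((i1 \o (k \o b1)) + (i2 \o (k' \o b2))).
exists ((j1 \o (f \o p1)) + (j2 \o (f' \o p2))).
set kk := _ + _; set ff := _ + _.
have ff1 : ff \o i1 = j1 \o f.
  by rewrite compDl -!compA p1i1 p2i1 !comp0r comp_idr addr0.
have ff2 : ff \o i2 = j2 \o f'.
  by rewrite compDl -!compA p1i2 p2i2 !comp0r comp_idr add0r.
have pkk1 : p1 \o kk = k \o b1.
  by rewrite compDr !compA p1i1 p1i2 !comp0l comp_idl addr0.
have pkk2 : p2 \o kk = k' \o b2.
  by rewrite compDr !compA p2i1 p2i2 !comp0l comp_idl add0r.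
have qff1 : q1 \o ff = f \o p1.
  by rewrite compDr !compA q1j1 q1j2 !comp0l comp_idl addr0.
have qff2 : q2 \o ff = f' \o p2.
  by rewrite compDr !compA q2j1 q2j2 !comp0l comp_idl add0r.
have ef : epi f by case: kf => _ /cokernel_epi.
have ef' : epi f' by case: kf' => _ /cokernel_epi.
apply: short_exact_epi; last first.
  apply/epi0P => Z g gff; rewrite -[g]comp_idr -jq compDr !compA.
  rewrite (epi_eq0 ef (g := g \o j1)); last first.
    by rewrite -compA -ff1 compA gff comp0l.
  rewrite (epi_eq0 ef' (g := g \o j2)); last first.
    by rewrite -compA -ff2 compA gff comp0l.
  by rewrite !comp0l addr0.
apply/kernelP; split.
- rewrite /ff compDl -!compA pkk1 pkk2 !(compA f) !(compA f').
  rewrite (short_exact_comp0 kf) (short_exact_comp0 kf').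
  by rewrite !comp0l !comp0r addr0.
- apply/mono0P => Z g kg; rewrite -[g]comp_idl -ab compDl -!compA.
  rewrite (mono_eq0 (short_exact_mono kf) (g := b1 \o g)); last first.
    by rewrite compA -pkk1 -compA kg comp0r.
  rewrite (mono_eq0 (short_exact_mono kf') (g := b2 \o g)); last first.
    by rewrite compA -pkk2 -compA kg comp0r.
  by rewrite !comp0r addr0.
- move=> Z g fg.
  have [|u ku] := short_exact_lift (g := p1 \o g) kf.
    by rewrite compA -qff1 -compA fg comp0r.
  have [|v kv] := short_exact_lift (g := p2 \o g) kf'.
    by rewrite compA -qff2 -compA fg comp0r.
  exists ((a1 \o u) + (a2 \o v)).
  rewrite /kk compDl !compDr -!compA !(compA b1) !(compA b2).
  rewrite b1a1 b1a2 b2a1 b2a2 !comp0l !comp_idl !comp0r addr0 add0r ku kv.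
  by rewrite !compA -compDl ip comp_idl.
Qed.

End Ab.

(** * Dual facts: pushouts, cokernels and retractions *)

Section AbDual.
Local Open Scope ring_scope.
Local Open Scope cat_scope.
Local Open Scope classical_set_scope.
Variable C : abelianCategory.
Implicit Types A B D K P Z N M E : C.

Lemma conflating_op A B D :
  conflating setT A B D <-> conflating (C := opposite C) setT D B A.
Proof.
by rewrite !conflatingT; split=> -[i [p /short_exact_op ip]]; exists p, i.
Qed.

Lemma ex_pushout A B D (f : hom D A) (g : hom D B) :
  exists P (a : hom A P) (b : hom B P), pushout a b f g.
Proof.
have [P [a [b [? ? ?]]]] := @ex_pullback (opposite C) A B D f g.
by exists P, a, b; split.
Qed.

Lemma pushout_short_exact P N A B D (p : hom A N) (f : hom D A) (g : hom D B)
    (a : hom A P) (b : hom B P) :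
  short_exact f p -> pushout a b f g ->
  exists p' : hom P N, short_exact b p' /\ p' \o a = p.
Proof.
move=> /short_exact_op s [? ? ?].
have [|p' [/short_exact_op ? ?]] :=
  @pullback_short_exact (opposite C) P N A B D p f g a b s; last by exists p'.
by split.
Qed.

Lemma ex_short_exact_mono A B (i : hom A B) :
  mono i -> exists D (p : hom B D), short_exact i p.
Proof.
move=> mi; have [D [p /short_exact_op ?]] :=
  @ex_short_exact_epi (opposite C) _ _ i mi.
by exists D, p.
Qed.

Lemma short_exact_desc A B D Z (i : hom A B) (p : hom B D) (g : hom B Z) :
  short_exact i p -> g \o i = 0 -> exists u : hom D Z, u \o p = g.
Proof. by move=> /short_exact_op; apply: (@short_exact_lift (opposite C)). Qed.

Lemma retraction_biproduct A B D (i : hom A B) (p : hom B D) (r : hom B A) :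
  short_exact i p -> r \o i = idm A ->
  exists s : hom D B,
    [/\ p \o s = idm D, r \o s = 0 & (i \o r) + (s \o p) = idm B].
Proof.
move=> /short_exact_op ip ri.
have [s [? ? sp]] := @section_biproduct (opposite C) D B A p i r ip ri.
by exists s; split=> //; rewrite addrC.
Qed.

Lemma conflating_pushout A B D K M :
  conflating setT A B D -> conflating setT A K M ->
  exists P, conflating setT K P D /\ conflating setT B P M.
Proof.
move=> /conflating_op s /conflating_op t.
have [P [? ?]] := @conflating_pullback (opposite C) _ _ _ _ _ s t.
by exists P; split; apply/conflating_op.
Qed.

Lemma conflating_comp_mono M H K D L :
  conflating setT M H D -> conflating setT H K L ->
  exists Q, conflating setT M K Q /\ conflating setT D Q L.
Proof.
move=> /conflating_op s /conflating_op t.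
have [P [? ?]] := @conflating_comp_epi (opposite C) _ _ _ _ _ t s.
by exists P; split; apply/conflating_op.
Qed.

End AbDual.

(** * Yoneda extensions: left-split sequences and the vanishing of Ext *)

Section YonedaExt.
Local Open Scope ring_scope.
Local Open Scope cat_scope.
Local Open Scope classical_set_scope.
Variable C : abelianCategory.
Implicit Types A B D E K L M N P Z : C.
Implicit Types S X : set C.

Definition extensionT A B D (i : hom A B) (p : hom B D) (ip : short_exact i p) :
    extension setT D A :=
  Extension (conj ip (And3 I I I)).

Lemma ext_ses S M N (x : extension S M N) : short_exact (ext_in x) (ext_out x).
Proof. by case: (ext_conflation x). Qed.

Lemma extension_mor_id S M N (x : extension S M N) :
  extension_mor (idm M) (idm N) x x.
Proof. by exists (idm _); rewrite !comp_idl !comp_idr. Qed.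

Lemma extension_mor_comp S M M' M'' N N' N'' (f : hom M M') (f' : hom M' M'')
    (g : hom N N') (g' : hom N' N'') (x : extension S M N)
    (x' : extension S M' N') (x'' : extension S M'' N'') :
  extension_mor f g x x' -> extension_mor f' g' x' x'' ->
  extension_mor (f' \o f) (g' \o g) x x''.
Proof.
move=> [u [ui pu]] [v [vi pv]]; exists (v \o u); split.
  by rewrite -compA ui compA vi compA.
by rewrite compA pv -compA pu compA.
Qed.

Lemma yext_mor_id S n M N (x : yext S n M N) : yext_mor (idm M) (idm N) x x.
Proof.
elim: n M x => [M x|[_ M x|n IH M x]] /=.
- by rewrite comp_idl comp_idr.
- exact: extension_mor_id.
- by exists (idm _); split; [exact: extension_mor_id|exact: IH].
Qed.

Lemma yext_mor_comp S n M M' M'' N N' N'' (f : hom M M') (f' : hom M' M'')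
    (g : hom N N') (g' : hom N' N'') (x : yext S n M N)
    (x' : yext S n M' N') (x'' : yext S n M'' N'') :
  yext_mor f g x x' -> yext_mor f' g' x' x'' ->
  yext_mor (f' \o f) (g' \o g) x x''.
Proof.
elim: n M M' M'' f f' x x' x'' => [|[_|n IH]] M M' M'' f f' x x' x'' /=.
- by move=> gx gx'; rewrite -compA gx compA gx' compA.
- exact: extension_mor_comp.
- move=> [k [m r]] [k' [m' r']]; exists (k' \o k).
  by split; [exact: extension_mor_comp m m'|exact: IH r r'].
Qed.

(* For [0 < n]: the inclusion of the left end [N] into the leftmost middle term
   has a retraction. *)
Fixpoint leftsplit S n M N : yext S n M N -> Prop :=
  match n with
  | 0 => fun _ => True
  | n'.+1 =>
    match n' as n1
      return (forall K, yext S n1 K N -> Prop) -> yext S n1.+1 M N -> Prop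
    with
    | 0 => fun _ x => exists r : hom (ext_mid x) N, r \o ext_in x = idm N
    | _.+1 => fun rec x => rec _ (projT2 x).2
    end (fun K => @leftsplit S n' K N)
  end.

Lemma leftsplit_mor S n M M' N (h : hom M M') (x : yext S n M N)
    (x' : yext S n M' N) :
  yext_mor h (idm N) x x' -> leftsplit x' -> leftsplit x.
Proof.
elim: n M M' h x x' => [//|[_|n IH]] M M' h x x' /=.
- move=> [u [ui _]] [r ri]; exists (r \o u).
  by rewrite -compA ui compA ri comp_idl.
- by move=> [k [_ m]]; apply: IH m.
Qed.

(** Lifting of [h] through the rightmost epimorphism of the sequence; the match reflects that
    extensions of degree one are not stored as spliced pairs. *)
Definition lifts S n M N P (h : hom P M) : yext S n.+1 M N -> Prop :=
  match n return yext S n.+1 M N -> Prop with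
  | 0 => fun x => exists f, ext_out x \o f = h
  | _.+1 => fun x => exists f, ext_out (projT2 x).1 \o f = h
  end.

Lemma lifts0 S n M N P (x : yext S n.+1 M N) : lifts (0 : hom P M) x.
Proof. by case: n x => [|n] x; exists 0; rewrite comp0r. Qed.

Lemma lifts_epi S n M N (x : yext S n.+1 M N) :
  exists E (e : hom E M), epi e /\
    forall P (h : hom P M), lifts h x <-> exists f, e \o f = h.
Proof.
case: n x => [|n] x.
  by exists _, (ext_out x); split=> //; apply: cokernel_epi (ext_ses x).2.
exists _, (ext_out (projT2 x).1); split=> //.
exact: cokernel_epi (ext_ses (projT2 x).1).2.
Qed.

(* A cospan of morphisms fixing the left end is completed to a span.  The square
   of right ends commutes only up to a map that factors through the rightmost
   epimorphism of [x']; the induction produces squares of this kind. *)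
Lemma yext_ore n M M' M'' P N (a : hom M M') (b : hom M'' M') (p : hom P M)
    (q : hom P M'') (x : yext setT n.+1 M N) (x' : yext setT n.+1 M' N)
    (x'' : yext setT n.+1 M'' N) :
  yext_mor a (idm N) x x' -> yext_mor b (idm N) x'' x' ->
  lifts ((a \o p) - (b \o q)) x' ->
  exists y : yext setT n.+1 P N,
    yext_mor p (idm N) y x /\ yext_mor q (idm N) y x''.
Proof.
elim: n M M' M'' P a b p q x x' x'' => [|n IH] M M' M'' P a b p q x x' x''.
  move=> /= [u [ui pu]] [u' [ui' pu']] [f pf].
  have [P1 [a1 [b1 pb]]] := ex_pullback (ext_out x) p.
  have [i1 [ib a1i]] := pullback_short_exact (ext_ses x) pb.
  have [xa _ _] := pb.
  have ui0 : u' \o ext_in x'' = ext_in x' by rewrite ui' comp_idr.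
  have [_ exw un] := extension_mor_pullback (ext_ses x'') (ext_ses x') ui0 pu'.
  (* [x''] is the pullback of [x'] along [b]; subtracting [f \o b1] corrects the failure of the
     square on [P] to commute. *)
  have [|t [u't pt]] := exw _ ((u \o a1) - (f \o b1)) (q \o b1).
    rewrite compBr !compA pu pf -(compA a) xa !compBl !compA.
    by rewrite opprB addrCA subrr addr0.
  exists (extensionT ib); split.
    by exists a1; rewrite /= comp_idr.
  exists t; split=> //=; rewrite comp_idr; apply: un.
    rewrite compA u't compBl -!compA a1i (short_exact_comp0 ib) comp0r subr0.
    by rewrite ui ui' !comp_idr.
  rewrite compA pt -compA (short_exact_comp0 ib) comp0r.
  by rewrite (short_exact_comp0 (ext_ses x'')).
case: x x' x'' => [K [s t]] [K' [s' t']] [K'' [s'' t'']].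
move=> [/= k [[u [ui pu]] mt]] [k'' [[u'' [ui'' pu'']] mt'']] [f pf].
have [P1 [a1 [b1 pb1]]] := ex_pullback (ext_out s) p.
have [P2 [a2 [b2 pb2]]] := ex_pullback (ext_out s'') (q \o b1).
have [sa1 _ _] := pb1; have [sa2 _ _] := pb2.
have eb1 := pullback_epi pb1 (cokernel_epi (ext_ses s).2).
have eb2 := pullback_epi pb2 (cokernel_epi (ext_ses s'').2).
(* [P2] covers [P], and on it [p] and [q] lift to the middle terms of [s] and [s'']. The images of
   these lifts in the middle of [s'] differ by the part coming from [f] and by [dl], which factors
   through [K']. *)
set dl := ((u \o (a1 \o b2)) - (u'' \o a2)) - (f \o (b1 \o b2)).
have [|d sd] := short_exact_lift (g := dl) (ext_ses s').
  rewrite !compBr !compA pu pu'' pf -!compA !(compA (ext_out _)) sa1 sa2 !compA.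
  by rewrite !compBl subrr.
(* On the further cover [F] the map [d] lifts through the rightmost epimorphism of [t']. This gives
   the lifting condition under which the induction hypothesis applies to the syzygies. *)
have [E2 [pi [epi_pi liftsE]]] := lifts_epi t'.
have [F [f2 [e pbF]]] := ex_pullback pi d.
have ee := pullback_epi pbF epi_pi; have [pf2 _ _] := pbF.
set out := b1 \o (b2 \o e).
have [L [j jout]] : exists L (j : hom L F), short_exact j out.
  by apply: ex_short_exact_epi; by apply: epi_comp => //; apply: epi_comp.
have out0 := short_exact_comp0 jout.
have [|al sal] := short_exact_lift (g := (a1 \o (b2 \o e)) \o j) (ext_ses s).
  by rewrite !compA sa1 -!(compA p) -(compA b1) out0 comp0r.
have [|be sbe] := short_exact_lift (g := (a2 \o e) \o j) (ext_ses s'').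
  by rewrite !compA sa2 -!(compA q) -!compA (compA b2) (compA b1) out0 comp0r.
have lft : lifts ((k \o al) - (k'' \o be)) t'.
  apply/liftsE; exists (f2 \o j).
  apply: (short_exact_mono (ext_ses s')).
  rewrite compBr [in RHS]compA -ui [in RHS]compA -ui''.
  rewrite -2!(compA _ (ext_in _)) sal sbe (compA pi) pf2 !compA sd /dl.
  rewrite !compBl -!compA (compA b2 e j) (compA b1) out0 comp0r subr0.
  by rewrite -!compA.
have [y [yt yt'']] := IH _ _ _ _ _ _ _ _ _ _ _ mt mt'' lft.
have outs : ext_out s \o (a1 \o (b2 \o e)) = p \o out.
  by rewrite /out !compA sa1.
have outs'' : ext_out s'' \o (a2 \o e) = q \o out.
  by rewrite /out !compA sa2 ?compA.
exists (existT _ L (extensionT jout, y)); split.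
  by exists al; split=> //; exists (a1 \o (b2 \o e)); split=> //; rewrite sal.
by exists be; split=> //; exists (a2 \o e); split=> //; rewrite sbe.
Qed.

(* Degree [n + 1] vanishing in these terms: every extension receives a morphism,
   fixing both ends, from a left-split one. *)
Definition covered S n M N (x : yext S n M N) : Prop :=
  exists y : yext S n M N, leftsplit y /\ yext_mor (idm M) (idm N) y x.

(** Along a generating morphism from [x] to [x'], a left-split cover of [x] is composed with it. A
    cover of [x'] is brought back by [yext_ore]: the resulting sequence maps to a left-split one, so
    it is left split. *)
Lemma covered_equiv n M N (x x' : yext setT n.+1 M N) :
  yoneda_equiv x x' -> covered x <-> covered x'.
Proof.
elim=> {x x'} [x x' m|x|x x' _ IH|x x' x'' _ IH _ IH'] //; first last.
- by rewrite IH.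
- by split=> /IH.
split=> -[y [ly my]].
  by exists y; split=> //; have := yext_mor_comp my m; rewrite !comp_idl.
have [|z [zx zy]] := yext_ore (p := idm M) (q := idm M) m my.
  by rewrite subrr; apply: lifts0.
by exists z; split=> //; apply: leftsplit_mor zy ly.
Qed.

Lemma Ext_vanishesP S n M N :
  Ext_vanishes S n M N <-> forall x y : yext S n M N, yoneda_equiv x y.
Proof.
split=> [V x y|eqv _ _ [x _ <-] [y _ <-]].
  have : [set z | yoneda_equiv x z] = [set z | yoneda_equiv y z].
    by apply: V; [exists x|exists y].
  by move=> /(congr1 (fun T : set _ => T y)) /= ->; apply: rst_refl.
rewrite predeqE => z /=; split=> h; apply: rst_trans h; exact: eqv.
Qed.

Lemma closed_ext_biproduct X P A B :
  closed_ext X -> is_biproduct P A B -> X A -> X B -> X P.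
Proof. by move=> cX /biproduct_conflating /cX; apply. Qed.

Lemma closed_summand_zero X A Z : closed_summand X -> X A -> is_zero Z -> X Z.
Proof.
move=> cX XA [Z0 Z0']; apply: (cX Z A A _ XA).
exists 0, (idm A), 0, (idm A).
by rewrite !comp_idl !comp_idr ?comp0l ?comp0r add0r; split=> //; apply: Z0.
Qed.

(** [z] represents the zero class. In degree one it is the biproduct; in higher degrees it starts
    with the identity of [M], whose kernel is a zero object, and goes on with the zero extension of
    that object. *)
Lemma zero_extension S n M N :
  closed_ext S -> (forall Z, is_zero Z -> S Z) -> S M -> S N ->
  exists z : yext S n.+1 M N, leftsplit z /\
    forall M' (h : hom M' M) (x : yext S n.+1 M' N),
      leftsplit x -> yext_mor h (idm N) x z.
Proof.
move=> cS S0 SM SN; elim: n M SM => [|n IH] M SM.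
  have [P bP] := ex_biproduct N M.
  have SP := closed_ext_biproduct cS bP SN SM.
  have [i1 [i2 [p1 [p2 [p1i1 p2i2 p1i2 p2i1 ip]]]]] := bP.
  have i1p2 := biproduct_short_exact p1i1 p2i2 p2i1 ip.
  exists (Extension (conj i1p2 (And3 SN SP SM))); split; first by exists p1.
  move=> M' h x [r ri]; exists ((i1 \o r) + (i2 \o (h \o ext_out x))) => /=.
  rewrite compDl compDr -!compA ri (short_exact_comp0 (ext_ses x)).
  rewrite !comp0r addr0 !compA p2i1 p2i2 comp0l comp_idl comp_idr.
  by rewrite add0r.
have [Z Z0] := @ex_zero C; have [z [lz zP]] := IH Z (S0 Z Z0).
have ses0 := zero_short_exact M Z0.
exists (existT _ Z (Extension (conj ses0 (And3 (S0 Z Z0) SM SM)), z)).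
split=> // M' h [K [s t]] lt; exists 0; split; last exact: zP.
exists (h \o ext_out s) => /=; rewrite comp_idl comp0l; split=> //.
by rewrite -compA (short_exact_comp0 (ext_ses s)) comp0r.
Qed.

Lemma covered_vanish S n M N :
  closed_ext S -> (forall Z, is_zero Z -> S Z) -> S M -> S N ->
  (forall x : yext S n.+1 M N, covered x) -> Ext_vanishes S n.+1 M N.
Proof.
move=> cS S0 SM SN cov; apply/Ext_vanishesP => x y.
have [z [_ zP]] := zero_extension n cS S0 SM SN.
have xz w : yoneda_equiv w z.
  have [w' [lw' ww']] := cov w.
  apply: (rst_trans _ _ _ w'); first exact/rst_sym/rst_step.
  exact/rst_step/zP.
by apply: (rst_trans _ _ _ z); [apply: xz|apply/rst_sym/xz].
Qed.

Lemma Ext_vanishes_covered n M N :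
  Ext_vanishes setT n.+1 M N <-> forall x : yext setT n.+1 M N, covered x.
Proof.
split=> [/Ext_vanishesP V x|]; last exact: covered_vanish.
have [z [lz _]] := @zero_extension setT n M N
  (fun _ _ _ _ _ _ => I) (fun _ _ => I) I I.
apply/(covered_equiv (V x z)); exists z; split=> //; exact: yext_mor_id.
Qed.

(** In degree one left splitting passes both ways along a morphism fixing the ends: a section is
    pushed forward, a retraction pulled back. The resulting criterion does not mention [S], so
    relative and ambient vanishing can be compared. *)
Lemma Ext1_vanishes S M N :
  closed_ext S -> (forall Z, is_zero Z -> S Z) -> S M -> S N ->
  Ext_vanishes S 1 M N <->
  forall E (i : hom N E) (p : hom E M), short_exact i p ->
    exists r : hom E N, r \o i = idm N.
Proof.
move=> cS S0 SM SN; split=> [/Ext_vanishesP V E i p ip|spl].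
  have SE : S E by apply: (cS N E M) => //; apply/conflatingT; exists i, p.
  have [z [lz _]] := zero_extension 0 cS S0 SM SN.
  suff eqL (x x' : yext S 1 M N) :
      yoneda_equiv x x' -> leftsplit x <-> leftsplit x'.
    have Vz := V (Extension (conj ip (And3 SN SE SM))) z.
    by have /(_ lz) := (eqL _ _ Vz).2.
  elim=> {x x'} [x x' m|x|x x' _ IH|x x' x'' _ IH _ IH'] //; first last.
  - by rewrite IH.
  - by split=> /IH.
  split; last exact: leftsplit_mor m.
  have xs := ext_ses (x : extension S M N).
  move=> [r ri].
  have [s [ps _ _]] := retraction_biproduct xs ri.
  case: m => u [_ pu]; have us : ext_out x' \o (u \o s) = idm M.
    by rewrite compA pu comp_idl ps.
  by have [r' [ri' _ _]] := section_biproduct (ext_ses x') us; exists r'.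
apply: covered_vanish => // x; exists x; split; last exact: yext_mor_id.
exact: spl (ext_ses x).
Qed.

Lemma Ext1_vanishesT M N :
  Ext_vanishes setT 1 M N <->
  forall E (i : hom N E) (p : hom E M), short_exact i p ->
    exists r : hom E N, r \o i = idm N.
Proof. exact: Ext1_vanishes. Qed.

Lemma Ext1_vanishes_relative S M N :
  closed_ext S -> (forall Z, is_zero Z -> S Z) -> S M -> S N ->
  Ext_vanishes S 1 M N <-> Ext_vanishes setT 1 M N.
Proof. by move=> *; rewrite Ext1_vanishesT Ext1_vanishes. Qed.

End YonedaExt.

(** * A piece of the long exact sequence, and dimension shifting *)

Section LongExact.
Local Open Scope ring_scope.
Local Open Scope cat_scope.
Local Open Scope classical_set_scope.
Variable C : abelianCategory.
Implicit Types A B D E K L M N P V Z : C.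
Implicit Types S F X : set C.

(** The connecting map: Yoneda product with the class of [s], attached at the left end. *)
Fixpoint splice S n M N K (s : extension S N K) :
    yext S n.+1 M N -> yext S n.+2 M K :=
  match n return yext S n.+1 M N -> yext S n.+2 M K with
  | 0 => fun x => existT _ N (x, s)
  | n'.+1 => fun x =>
      existT _ (projT1 x)
        ((projT2 x).1, @splice S n' (projT1 x) N K s (projT2 x).2)
  end.

(* Subtracting a retraction of the left end from the chain map makes it factor
   through the quotient by the left end. *)
Lemma leftsplit_splice n M M' N K (s : extension setT N K) (h : hom M' M)
    (x : yext setT n.+1 M N) (y : yext setT n.+2 M' K) :
  yext_mor h (idm K) y (splice s x) -> leftsplit y ->
  exists x' : yext setT n.+1 M' (ext_mid s), yext_mor h (ext_out s) x' x.
Proof.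
elim: n M M' h x y => [|n IH] M M' h x y.
  case: y => I [y t] [k [[u [/= ui pu]] [v [/= vi pv]]]] [r ri].
  have ss := ext_ses s; have tt := ext_ses t.
  have [|g gt] := short_exact_desc (g := v - (ext_in s \o r)) tt.
    by rewrite compBl vi -compA ri !comp_idr subrr.
  have sg : ext_out s \o g = k.
    apply: (cokernel_epi tt.2).
    by rewrite -compA gt compBr compA (short_exact_comp0 ss) comp0l subr0.
  (* [g] maps the syzygy [I] to the middle of [s]; pushing [y] out along it gives the required
     extension by that middle term. *)
  have [P [a [b ab]]] := ex_pushout (ext_in y) g.
  have [p [bp pa]] := pushout_short_exact (ext_ses y) ab.
  have [ai exw un] := ab.
  have [|w [wa wb]] := exw _ u (ext_in (x : extension _ _ _) \o ext_out s).
    by rewrite ui -compA sg.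
  exists (extensionT bp); exists w; split=> //=; apply: un.
    by rewrite -!compA wa pu pa.
  rewrite -!compA wb (short_exact_comp0 bp) comp0r compA.
  by rewrite (short_exact_comp0 (ext_ses (x : extension _ _ _))) comp0l.
case: x y => [I [x t]] [I' [y t']] [k [m mt]] ls.
have [x' mx'] := IH _ _ k t t' mt ls.
by exists (existT _ I' (y, x')); exists k.
Qed.

(** The pushout along [p] at the left end stays split, because [p] after the retraction and the
    identity of [N'] agree on [N]. *)
Lemma yext_push n M N N' (p : hom N N') (x : yext setT n.+1 M N) :
  leftsplit x ->
  exists y : yext setT n.+1 M N', leftsplit y /\
    forall M' (h : hom M M') (z : yext setT n.+1 M' N'),
      yext_mor h p x z -> yext_mor h (idm N') y z.
Proof.
elim: n M x => [|n IH] M x.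
  move=> [r ri].
  have [P [a [b ab]]] := ex_pushout (ext_in (x : extension _ _ _)) p.
  have xs := ext_ses (x : extension _ _ _).
  have [q [bq qa]] := pushout_short_exact xs ab.
  have [ai exw un] := ab.
  exists (extensionT bq); split.
    have [|w [_ wb]] := exw _ (p \o r) (idm N'); last by exists w.
    by rewrite -compA ri comp_idl comp_idr.
  move=> M' h z [u [/= ui zu]]; have [w [wa wb]] := exw _ _ _ ui.
  exists w; rewrite /= comp_idr; split=> //; apply: un.
    by rewrite -!compA wa zu qa.
  rewrite -!compA wb (short_exact_comp0 bq) comp0r.
  by rewrite (short_exact_comp0 (ext_ses (z : extension _ _ _))).
case: x => I [x t] lt; have [y [ly yP]] := IH I t lt.
exists (existT _ I (x, y)); split=> // M' h [I' [z t']] [k [m mt]].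
by exists k; split=> //; apply: yP.
Qed.

(** Exactness on representatives: a left-split cover of the splice of [x] yields an extension by [V]
    mapping to [x]. That extension has a left-split cover in turn, whose pushout to [N] covers
    [x]. *)
Lemma Ext_vanishes_quotient n A K V N :
  conflating setT K V N -> Ext_vanishes setT n.+1 A V ->
  Ext_vanishes setT n.+2 A K -> Ext_vanishes setT n.+1 A N.
Proof.
move=> /conflatingT[i [p ip]] /Ext_vanishes_covered VV /Ext_vanishes_covered VK.
apply/Ext_vanishes_covered => x.
have [y [ly my]] := VK (splice (extensionT ip) x).
have [x' mx'] := leftsplit_splice my ly.
have [x0 [lx0 mx0]] := VV x'.
have := yext_mor_comp mx0 mx'; rewrite comp_idl comp_idr => m.
by have [z [lz zP]] := yext_push p lx0; exists z; split=> //; apply: zP.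
Qed.

Lemma yext_pull S n M P N (k : hom P M) (x : yext S n.+1 M N) :
  closed_ext S -> S P ->
  exists y : yext S n.+1 P N, yext_mor k (idm N) y x.
Proof.
move=> cS SP.
have pull K (s : extension S M K) :
    exists t : extension S P K, extension_mor k (idm K) t s.
  have [_ [SK _ _]] := ext_conflation s.
  have [Q [a [b ab]]] := ex_pullback (ext_out s) k.
  have [j [jb aj]] := pullback_short_exact (ext_ses s) ab.
  have SQ : S Q by apply: (cS K Q P) => //; apply/conflatingT; exists j, b.
  exists (Extension (conj jb (And3 SK SQ SP))), a; rewrite /= comp_idr aj.
  by case: ab.
case: n x => [|n]; first exact: pull.
move=> [K [s t]]; have [s' ms] := pull K s.
by exists (existT _ K (s', t)), (idm K); split=> //; apply: yext_mor_id.
Qed.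

(* Dimension shifting: [x] is dominated by an extension whose first syzygy is in
   [F] again, so by induction by a left-split one. *)
Lemma Ext_vanishes_hereditary S F D :
  closed_ext S -> (forall Z, is_zero Z -> S Z) -> F `<=` S -> S D ->
  (forall K E A (i : hom K E) (p : hom E A), conflation S i p -> F A ->
    exists K' A' (i' : hom K' A') (u : hom A' E),
      conflation S i' (p \o u) /\ F K') ->
  (forall A, F A -> Ext_vanishes S 1 A D) ->
  forall n A, F A -> Ext_vanishes S n.+1 A D.
Proof.
move=> cS S0 FS SD cover V1 n A FA.
suff cov (x : yext S n.+1 A D) : covered x.
  by apply: covered_vanish => //; apply: FS.
elim: n A FA x => [|n IH] A FA x.
  have xs := ext_ses (x : extension _ _ _).
  have [r ri] := (Ext1_vanishes cS S0 (FS _ FA) SD).1 (V1 A FA) _ _ _ xs.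
  by exists x; split; [exists r|apply: yext_mor_id].
case: x => K [s t].
have [K' [A' [i' [u [cu FK']]]]] := cover _ _ _ _ _ (ext_conflation s) FA.
have [|k kP] := short_exact_lift (g := u \o i') (ext_ses s).
  by rewrite compA; apply: short_exact_comp0 cu.1.
have [t1 m1] := yext_pull k t cS (FS _ FK').
have [t2 [l2 m2]] := IH _ FK' t1.
have m21 := yext_mor_comp m2 m1; rewrite comp_idl comp_idr in m21.
exists (existT _ K' (Extension cu, t2)); split=> //; exists k; split=> //.
by exists u; rewrite /= comp_idl kP.
Qed.

End LongExact.

(** * Orthogonality for Ext^1, and resolutions described by recursion *)

Section Orthogonality.
Local Open Scope ring_scope.
Local Open Scope cat_scope.
Local Open Scope classical_set_scope.
Variable C : abelianCategory.
Implicit Types A B D E K L M N P V Z : C.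
Implicit Types S F X : set C.

Lemma rperp1P X N :
  rperp_i setT 1 X N <-> forall M, X M -> Ext_vanishes setT 1 M N.
Proof. by split=> [[]|]. Qed.

Lemma Ext1_lift A N E M (i : hom N E) (p : hom E M) (f : hom A M) :
  Ext_vanishes setT 1 A N -> short_exact i p -> exists g, p \o g = f.
Proof.
move=> /Ext1_vanishesT V ip; have [P [a [b ab]]] := ex_pullback p f.
have [j [jb _]] := pullback_short_exact ip ab.
have [r rj] := V _ _ _ jb; have [s [bs _ _]] := retraction_biproduct jb rj.
exists (a \o s); have [pa _ _] := ab.
by rewrite compA pa -compA bs comp_idr.
Qed.

Lemma Ext1_extend K V M N (j : hom K V) (q : hom V M) (c : hom K N) :
  Ext_vanishes setT 1 M N -> short_exact j q -> exists e, e \o j = c.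
Proof.
move=> /Ext1_vanishesT EV jq; have [P [a [b ab]]] := ex_pushout j c.
have [p [bp _]] := pushout_short_exact jq ab.
have [r rb] := EV _ _ _ bp; exists (r \o a); have [aj _ _] := ab.
by rewrite -compA aj compA rb comp_idl.
Qed.

Lemma section_splits A N E (i : hom N E) (p : hom E A) :
  short_exact i p -> (exists s, p \o s = idm A) <-> (exists r, r \o i = idm N).
Proof.
move=> ip; split=> [[s]|[r]].
  by case/(section_biproduct ip)=> r []; exists r.
by case/(retraction_biproduct ip)=> s []; exists s.
Qed.

(** [q] extends over [E] to a map [t], whose kernel is an extension of [A] by [N1]; a section of
    that extension is also one of [p]. *)
Lemma Ext1_closed_ext A N1 N2 N3 :
  conflating setT N1 N2 N3 ->
  Ext_vanishes setT 1 A N1 -> Ext_vanishes setT 1 A N3 ->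
  Ext_vanishes setT 1 A N2.
Proof.
move=> /conflatingT[j [q jq]] V1 V3; apply/Ext1_vanishesT => E i p ip.
have [t ti] := Ext1_extend q V3 ip.
have et : epi t.
  apply/epi0P => Z g gt; apply: (epi_eq0 (cokernel_epi jq.2)).
  by rewrite -ti compA gt comp0l.
have [L [l lt]] := ex_short_exact_epi et.
have [|j' lj'] := short_exact_lift (g := i \o j) lt.
  by rewrite compA ti (short_exact_comp0 jq).
have pl : short_exact j' (p \o l).
  apply: short_exact_epi; last first.
    apply/epi0P => Z g gpl; have [|c ct] := short_exact_desc (g := g \o p) lt.
      by rewrite -compA.
    apply: (epi_eq0 (cokernel_epi ip.2)); rewrite -ct.
    rewrite (epi_eq0 (cokernel_epi jq.2) (g := c)) ?comp0l //.
    by rewrite -ti compA ct -compA (short_exact_comp0 ip) comp0r.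
  apply/kernelP; split.
  - by rewrite -compA lj' compA (short_exact_comp0 ip) comp0l.
  - apply/mono0P => Z g jg; apply: (mono_eq0 (short_exact_mono jq)).
    apply: (mono_eq0 (short_exact_mono ip)).
    by rewrite compA -lj' -compA jg comp0r.
  - move=> Z z plz; have [|w iw] := short_exact_lift (g := l \o z) ip.
      by rewrite compA.
    have [|v jv] := short_exact_lift (g := w) jq.
      by rewrite -ti -compA iw compA (short_exact_comp0 lt) comp0l.
    exists v; apply: (short_exact_mono lt).
    by rewrite compA lj' -compA jv iw.
apply/(section_splits ip).
have [s ps] := Ext1_lift (idm A) V1 pl.
by exists (l \o s); rewrite compA.
Qed.

Lemma closed_ext_rperp1 X : closed_ext (rperp_i setT 1 X).
Proof.
move=> A B D s /rperp1P VA /rperp1P VD; apply/rperp1P => M XM.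
exact: (Ext1_closed_ext s (VA M XM) (VD M XM)).
Qed.

Lemma closed_summand_rperp1 X : closed_summand (rperp_i setT 1 X).
Proof.
move=> A A' B [i1 [i2 [p1 [p2 [p1i1 _ _ _ _]]]]] /rperp1P VB.
apply/rperp1P => M XM; apply/Ext1_vanishesT => E i p ip.
have [e ei] := Ext1_extend i1 (VB M XM) ip.
by exists (p1 \o e); rewrite -compA ei.
Qed.

Lemma conflating_split A K P :
  Ext_vanishes setT 1 A K -> conflating setT K P A -> is_biproduct P K A.
Proof.
move=> /Ext1_vanishesT V /conflatingT[i [p ip]]; have [r ri] := V _ _ _ ip.
have [s [ps rs irsp]] := retraction_biproduct ip ri.
exists i, s, r, p; split=> //; exact: short_exact_comp0 ip.
Qed.

Lemma is_biproductC P A B : is_biproduct P A B -> is_biproduct P B A.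
Proof.
move=> [i1 [i2 [p1 [p2 [? ? ? ? ip]]]]]; exists i2, i1, p2, p1.
by split=> //; rewrite addrC.
Qed.

(** Recursive form of [resolved], suited to induction on the first syzygy; [resolvedE] identifies
    the two for classes closed under summands. *)
Fixpoint resdim X m : set C :=
  match m with
  | 0 => X
  | m'.+1 => [set M | exists K P,
      [/\ conflating setT K P M, X P & resdim X m' K]]
  end.

Lemma zero_kernel_iso K P M (k : hom K P) (e : hom P M) :
  is_zero K -> short_exact k e ->
  exists g : hom M P, e \o g = idm M /\ g \o e = idm P.
Proof.
move=> K0 ke; have [|g ge] := short_exact_desc (g := idm P) ke.
  by rewrite comp_idl; apply: K0.2.
exists g; split=> //; apply: (cokernel_epi ke.2).
by rewrite -compA ge comp_idr comp_idl.
Qed.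

Lemma closed_summand_iso X A B (f : hom A B) (g : hom B A) :
  closed_summand X -> f \o g = idm B -> g \o f = idm A -> X A -> X B.
Proof.
move=> cX fg gf; have [Z Z0] := @ex_zero C; apply: (cX B Z A).
exists g, 0, f, 0; split; rewrite ?comp0r ?comp0l ?addr0 //.
by apply/esym/Z0.1.
Qed.

Lemma resolved_resdim X m M :
  closed_summand X -> resolved X m M -> resdim X m M.
Proof.
move=> cX; elim: m M => [|m IH] M [P [d [e [PX P0 ee ex0 dd]]]];
  have [K [k [c [ke ec dc]]]] := ex0.
  (* For [m = 0] the object [P 1] is zero, hence so is its quotient [K], and [e] is invertible. *)
  have K0 : is_zero K.
    have idK : idm K = 0 by apply: ec; apply: from_zero_eq (P0 1%N isT).
    split=> A f; first by rewrite -[f]comp_idl idK comp0l.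
    by rewrite -[f]comp_idr idK comp0r.
  have [g [eg ge]] := zero_kernel_iso K0 (short_exact_epi ke ee).
  by apply: closed_summand_iso cX eg ge _; apply: PX.
exists K, (P 0%N); split; [|exact: PX|apply: IH].
  by apply/conflatingT; exists k, e; apply: short_exact_epi.
exists (fun i => P i.+1), (fun i => d i.+1), c; split=> //.
- by move=> i im; apply: PX.
- by move=> i im; apply: P0.
have [K1 [k1 [c1 [/kernelP[dk1 mk1 k1P] ec1 dc1]]]] := dd 0%N.
exists K1, k1, c1; split=> //; apply/kernelP; split=> //.
  by apply: (kernel_mono ke); rewrite compA -dc dk1 comp0r.
by move=> Z g cg; apply: k1P; rewrite dc -compA cg comp0r.
Qed.

Lemma resdim_resolved X m M : resdim X m M -> resolved X m M.
Proof.
have [Z Z0] := @ex_zero C.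
elim: m M => [|m IH] M /=.
  move=> XM.
  have ez A B (f : hom A Z) (g : hom Z B) : exact_at f g.
    exists Z, (idm Z), f; split; last by rewrite comp_idl.
      apply/kernelP; split; first exact: from_zero_eq.
        by move=> Y u v _; apply: to_zero_eq.
      by move=> Y u _; exists u; rewrite comp_idl.
    by move=> Y u v _; apply: from_zero_eq.
  exists (fun i => if i is _.+1 then Z else M), (fun i => 0), (idm M); split.
  - by case.
  - by case.
  - by move=> Y u v; rewrite !comp_idr.
  - exists Z, 0, 0; split; first by case: (zero_short_exact M Z0).
      by move=> Y u v _; apply: from_zero_eq.
    by rewrite comp0l.
  - by move=> i; apply: ez.
move=> [K [P [/conflatingT[k [e ke]] XP /IH[Q [d [c [QX Q0 ec cd dd]]]]]]].
exists (fun i => if i is j.+1 then Q j else P).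
exists (fun i => match i return hom (Q i) (if i is j.+1 then Q j else P) with
                 | 0 => k \o c | j.+1 => d j end), e; split.
- by case.
- by case.
- exact: cokernel_epi ke.2.
- by exists K, k, c; split=> //; case: ke.
case=> [|i]; last exact: dd.
have [K1 [k1 [c1 [/kernelP[ck1 mk1 k1P] ec1 dc1]]]] := cd.
exists K1, k1, c1; split=> //; apply/kernelP; split=> //.
  by rewrite -compA ck1 comp0r.
move=> Y g kcg; apply: k1P; apply: (short_exact_mono ke).
by rewrite compA kcg comp0r.
Qed.

Lemma resolvedE X m : closed_summand X -> resolved X m = resdim X m.
Proof.
move=> cX; rewrite predeqE => M.
by split; [exact: resolved_resdim|exact: resdim_resolved].
Qed.

Lemma resdim_sub X X' m : X `<=` X' -> resdim X m `<=` resdim X' m.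
Proof.
move=> sub; elim: m => [//|m IH] M [K [P [s XP /IH rK]]].
by exists K, P; split=> //; apply: sub.
Qed.

Lemma resdimS X m : closed_summand X -> resdim X m `<=` resdim X m.+1.
Proof.
move=> cX; elim: m => [|m IH] M.
  move=> XM; have [Z Z0] := @ex_zero C.
  exists Z, M; split=> //; last exact: closed_summand_zero cX XM Z0.
  by apply/conflatingT; exists 0, (idm M); apply: zero_short_exact.
by move=> [K [P [s XP /IH rK]]]; exists K, P.
Qed.

Lemma resdim0 X m : closed_summand X -> X `<=` resdim X m.
Proof. by move=> cX; elim: m => [//|m IH] M /IH; apply: resdimS. Qed.

End Orthogonality.

(** * Approximations and resolution dimension for a Frobenius pair *)

Section FrobeniusPair.
Local Open Scope classical_set_scope.
Variables (C : abelianCategory) (X W : set C).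
Hypothesis frobXW : frobenius_pair X W.
Implicit Types A B D E K L M N P V Z : C.

Let cX : closed_ext X. Proof. by case: frobXW => -[]. Qed.
Let kX : closed_ker_epi X. Proof. by case: frobXW => -[]. Qed.
Let sX : closed_summand X. Proof. by case: frobXW => -[]. Qed.
Let sW : closed_summand W. Proof. by case: frobXW. Qed.
Let WX : W `<=` X. Proof. by case: frobXW. Qed.

(** Auslander-Buchweitz approximations, by a joint induction. A preenvelope of the syzygy is pushed
    out to a precover one degree up; embedding the [P] of that precover into an object [V] of [W]
    and dividing by [K] gives the preenvelope there. *)
Lemma special_preenvelope_precover m :
  (forall M, resdim X m M ->
     exists H D, [/\ conflating setT M H D, resdim W m H & X D]) /\
  (forall M, resdim X m.+1 M ->
     exists K P, [/\ conflating setT K P M, X P & resdim W m K]).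
Proof.
suff cover n : (forall M, resdim X n M ->
     exists H D, [/\ conflating setT M H D, resdim W n H & X D]) ->
   forall M, resdim X n.+1 M ->
     exists K P, [/\ conflating setT K P M, X P & resdim W n K].
  elim: m => [|m [_ IH]].
    have E : forall M, resdim X 0 M ->
      exists H D, [/\ conflating setT M H D, resdim W 0 H & X D].
      by case: frobXW.
    by split=> //; apply: cover.
  have E : forall M, resdim X m.+1 M ->
      exists H D, [/\ conflating setT M H D, resdim W m.+1 H & X D].
    move=> M /IH[K [P [s XP rK]]].
    have [V [D [t WV XD]]] : exists V D, [/\ conflating setT P V D, W V & X D].
      by case: frobXW => _ _ _ _; apply.
    have [Q [Q1 Q2]] := conflating_comp_mono s t.
    by exists Q, D; split=> //; exists K, V.
  by split=> //; apply: cover.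
move=> env M [K [P [s XP /env[H [D [t rH XD]]]]]].
have [Q [Q1 Q2]] := conflating_pushout s t.
by exists H, Q; split=> //; apply: cX Q2 XP XD.
Qed.


Lemma resdim_preenvelope m M : resdim X m M ->
  exists H D, [/\ conflating setT M H D, resdim W m H & X D].
Proof. by case: (special_preenvelope_precover m) => + _; apply. Qed.

Lemma resdim_precover m M : resdim X m.+1 M ->
  exists K P, [/\ conflating setT K P M, X P & resdim W m K].
Proof. by case: (special_preenvelope_precover m) => _; apply. Qed.

(** Ext^(n+1) at [N] sits between Ext^(n+1) at [V] and Ext^(n+2) at [K], so [n] must vary in the
    induction on [m]. *)
Lemma Ext_vanishes_resdim n m A N :
  X A -> resdim W m N -> Ext_vanishes setT n.+1 A N.
Proof.
move=> XA; elim: m n N => [|m IH] n N.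
  by move=> WN; case: frobXW => _ _ V _ _; apply: V.
move=> [K [V [s WV rK]]]; apply: (Ext_vanishes_quotient s); last exact: IH.
by case: frobXW => _ _ V1 _ _; apply: V1.
Qed.

Lemma resdim_rperp1 m : resdim W m `<=` rperp_i setT 1 X.
Proof.
by move=> N rN; apply/rperp1P => M XM; apply: Ext_vanishes_resdim rN.
Qed.

(** Only the degree-zero term of the resolution changes: it becomes an extension of [P] by [A]. *)
Lemma resdim_extension m A Q L :
  conflating setT A Q L -> X A -> resdim X m L -> resdim X m Q.
Proof.
case: m => [|m] s XA; first exact: cX s XA.
move=> [K [P [t XP rK]]]; have [N [N1 N2]] := conflating_pullback s t.
by exists K, N; split=> //; apply: cX N1 XA XP.
Qed.

Lemma resdim_kernel m N P M :
  conflating setT N P M -> resdim X m P -> X M -> resdim X m N.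
Proof.
case: m => [|m] s; first exact: kX s.
move=> [K [P0 [t XP rK]]] XM; have [Q [Q1 Q2]] := conflating_comp_epi t s.
by exists K, Q; split=> //; apply: kX Q1 XP XM.
Qed.

(** Schanuel's argument: the pullback of [P] and a precover [P0] of [M] splits as [K] plus [P], by
    vanishing of Ext^1 from [X] to [K], and [N] is the kernel of its projection to [P0]. *)
Lemma resdim_syzygy m N P M :
  conflating setT N P M -> X P -> resdim X m.+1 M -> resdim X m N.
Proof.
move=> s XP /resdim_precover[K [P0 [t XP0 rK]]].
have [Q [Q1 Q2]] := conflating_pullback t s.
have bQ := conflating_split (Ext_vanishes_resdim XP rK) Q1.
apply: (resdim_kernel Q2 _ XP0).
apply: (resdim_extension (biproduct_conflating (is_biproductC bQ)) XP).
exact: resdim_sub WX _ rK.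
Qed.

(** [P] maps onto both summands of [B], with kernels [Q] and [Q']. Their biproduct is a syzygy of
    [B] with respect to two copies of [P], so it has smaller dimension and the induction hypothesis
    applies to [Q]. *)
Lemma closed_summand_resdim m : closed_summand (resdim X m).
Proof.
elim: m => [|m IH] A A' B bB; first exact: sX bB.
move=> rB; have [K [P [s XP rK]]] := rB.
have [Q [Q1 _]] :=
  conflating_comp_epi s (biproduct_conflating (is_biproductC bB)).
have [Q' [Q'1 _]] := conflating_comp_epi s (biproduct_conflating bB).
have [PP bPP] := ex_biproduct P P.
have [N [N1 bN]] := conflating_biproduct Q1 Q'1 bPP bB.
exists Q, P; split=> //; apply: (IH _ _ _ bN); apply: (resdim_syzygy N1 _ rB).
exact: (closed_ext_biproduct cX bPP).

Qed.

(* For [K >-> P ->> M] with [K] in [resdim W m] and [P >-> V ->> D], the object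
   [V / K] lies in [resdim W m.+1], so maps [K -> N] extend to [V], hence to
   [P]; no vanishing of Ext^2 is needed. *)
Lemma Ext1_resdim m M N :
  resdim X m M -> rperp_i setT 1 (resdim W m) N -> rperp_i setT 1 X N ->
  Ext_vanishes setT 1 M N.
Proof.
case: m => [|m] rM /rperp1P VW /rperp1P VX; first exact: VX.
have [K [P [/conflatingT[k [f kf]] XP rK]]] := resdim_precover rM.
have [V [D [/conflatingT[v [w vw]] WV XD]]] :
    exists V D, [/\ conflating setT P V D, W V & X D].
  by case: frobXW => _ _ _ _; apply.
apply/Ext1_vanishesT => E i p ip; apply/(section_splits ip).
have [g pg] := Ext1_lift f (VX P XP) ip.
have [|c ic] := short_exact_lift (g := comp g k) ip.
  by rewrite compA pg (short_exact_comp0 kf).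
have [H [q vkq]] : exists H (q : hom V H), short_exact (comp v k) q.
  apply: ex_short_exact_mono => Z y z; rewrite -!compA.
  by move=> /(short_exact_mono vw)/(short_exact_mono kf).
have rH : resdim W m.+1 H.
  by exists K, V; split=> //; apply/conflatingT; exists (comp v k), q.
(* On [K] the maps [g] and [i] after [e] after [v] agree, so their difference descends to a section
   of [p]. *)
have [e evk] := Ext1_extend c (VW H rH) vkq.
have [|s sf] := short_exact_desc (g := (g - comp i (comp e v))%R) kf.
  by rewrite compBl -!compA evk ic subrr.
exists s; apply: (cokernel_epi kf.2).
rewrite -compA sf compBr pg (compA p) (short_exact_comp0 ip) comp0l subr0.
by rewrite comp_idl.
Qed.

(** * The right-hand class [G] and the resulting cotorsion pairs *)

Variable m : nat.
Let G : set C := rperp_i setT 1 (resdim W m) `&` rperp_i setT 1 X.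

Lemma Ext1_resdim_rperp M N : resdim X m M -> G N -> Ext_vanishes setT 1 M N.
Proof. by move=> rM [] /(Ext1_resdim rM). Qed.

Lemma rperp1_resdim_sub N : rperp_i setT 1 (resdim X m) N -> G N.
Proof.
move=> /rperp1P V; split; apply/rperp1P => M.
  by move=> /(resdim_sub WX)/V.
by move=> /(resdim0 m sX)/V.
Qed.

(** The enlarged right term is an extension of [L] by an object orthogonal to [X], hence orthogonal
    to [X]; the other new term is an extension of [L] by an object of [X], hence in [resdim X m]. *)
Lemma rperp_approximations M :
  (forall N, rperp_i setT 1 X N -> exists K L,
     [/\ conflating setT N K L, resdim W m L
       & rperp_i setT 1 (resdim W m) K]) ->
  has_approximations setT X (rperp_i setT 1 X) M ->
  has_approximations setT (resdim X m) G M.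
Proof.
move=> cpl [[D [A [s XA DX]]] [H [D' [s' XD' HX]]]]; split.
- have [K [L [t rL KW]]] := cpl _ DX.
  have [P [P1 P2]] := conflating_pushout s t.
  exists K, P; split=> //.
    exact: resdim_extension P2 XA (resdim_sub WX rL).
  split=> //; exact: closed_ext_rperp1 t DX (resdim_rperp1 rL).
- have [K [L [t rL KW]]] := cpl _ HX.
  have [Q [Q1 Q2]] := conflating_comp_mono s' t.
  exists K, Q; split=> //.
    exact: resdim_extension Q2 XD' (resdim_sub WX rL).
  split=> //; exact: closed_ext_rperp1 t HX (resdim_rperp1 rL).
Qed.

Lemma finitely_resolved_approximations M :
  finitely_resolved X M -> has_approximations setT X (rperp_i setT 1 X) M.
Proof.
move=> [n _ /(resolved_resdim sX) rM]; split.
  (* Precovers are available in successor degrees, so the dimension is first raised to [n + 1]. *)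
  have [K [P [s XP rK]]] := resdim_precover (resdimS sX rM).
  by exists K, P; split=> //; apply: resdim_rperp1 rK.
have [H [D [s rH XD]]] := resdim_preenvelope rM.
by exists H, D; split=> //; apply: resdim_rperp1 rH.
Qed.

Lemma resdim_summand_approximation M :
  (exists D A, [/\ conflating setT D A M, resdim X m A
                 & Ext_vanishes setT 1 M D]) ->
  resdim X m M.
Proof.
move=> [D [A [s rA VM]]]; have bA := conflating_split VM s.
exact: closed_summand_resdim (is_biproductC bA) rA.
Qed.

Lemma resdim_cotorsion_pair_cut :
  (forall N, rperp_i setT 1 X N -> exists K L,
     [/\ conflating setT N K L, resdim W m L
       & rperp_i setT 1 (resdim W m) K]) ->
  cotorsion_pair_cut_along (resdim X m) G (finitely_resolved X).
Proof.
move=> cpl; have appr M : finitely_resolved X M ->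
    has_approximations setT (resdim X m) G M.
  by move=> /finitely_resolved_approximations; apply: rperp_approximations.
split=> //.
- exact: closed_summand_resdim.
- move=> A A' B bB [GW GX].
  split; first exact: closed_summand_rperp1 bB GW.
  exact: closed_summand_rperp1 bB GX.
- rewrite predeqE => M; split=> -[rM fM]; split=> //.
    by split=> // N; apply: Ext1_resdim_rperp.
  have [[D [A [s rA GD]]] _] := appr M fM.
  by apply: resdim_summand_approximation; exists D, A; split=> //; apply: rM.2.
- rewrite predeqE => N; split=> -[rN fN]; split=> //.
    by apply/rperp1P => M rM; apply: Ext1_resdim_rperp.
  exact: rperp1_resdim_sub.
Qed.

Hypothesis approxX : forall M, has_approximations setT X (rperp_i setT 1 X) M.

(** The ambient approximations of objects of [B] stay in [B], by closure under kernels of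
    epimorphisms on one side and under extensions on the other, and Ext^1 vanishes in [B] exactly
    when it does in the ambient category. *)
Lemma resdim_cotorsion_pair (B : set C) :
  left_thick B -> resdim X m `<=` B ->
  (forall N, rperp_i setT 1 X N -> exists K L,
     [/\ conflating setT N K L, resdim W m L
       & rperp_i setT 1 (resdim W m) K]) ->
  hereditary_complete_cotorsion_pair B (resdim X m) (G `&` B).
Proof.
move=> [cB kB sB] FB cpl.
have appr M := rperp_approximations cpl (approxX M).
have B0 Z : is_zero Z -> B Z.
  (* An approximation of [Z] supplies an object of [X], which has the zero object as a summand. *)
  move=> Z0; have [[D [A [_ XA _]]] _] := approxX Z.
  exact: closed_summand_zero sB (FB _ (resdim0 m sX XA)) Z0.
have relconf A E D : conflating setT A E D -> B A -> B E -> B D ->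
    conflating B A E D.
  by move=> /conflatingT[i [p ip]] *; exists i, p.
have V1 A D : resdim X m A -> (G `&` B) D -> Ext_vanishes B 1 A D.
  move=> rA [GD BD]; apply/Ext1_vanishes_relative => //; first exact: FB.
  exact: Ext1_resdim_rperp.
have lappr M : B M -> exists D A,
    [/\ conflating B D A M, resdim X m A & (G `&` B) D].
  move=> BM; have [[D [A [s rA GD]]] _] := appr M.
  have BD := kB _ _ _ s (FB _ rA) BM.
  by exists D, A; split=> //; apply: relconf => //; apply: FB.
split.
- split.
    rewrite predeqE => N; split=> [[BN V]|GN]; last first.
      by split=> [|M rM]; [case: GN|apply: V1].
    split=> //; apply: rperp1_resdim_sub; apply/rperp1P => M rM.
    by apply/(Ext1_vanishes_relative cB B0 (FB _ rM) BN); apply: V.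
  rewrite predeqE => M; split=> [rM|[BM V]].
    by split=> [|N GN]; [apply: FB|apply: V1].
  have [D [A [[i [p [ip _]]] rA GD]]] := lappr M BM.
  apply: resdim_summand_approximation; exists D, A; split=> //.
    by apply/conflatingT; exists i, p.
  apply/(Ext1_vanishes_relative cB B0 BM GD.2); exact: V.
- move=> [//|n] A D _ rA GD.
  apply: (@Ext_vanishes_hereditary C B (resdim X m) D) => //.
  + by case: GD.
  + move=> K E A0 i p [ip [BK BE BA]] rA0.
    (* Covering [E] by an object [P] of [X] replaces the syzygy [K] by the kernel of [P] onto [A0],
       which belongs to [resdim X m]. *)
    have [[D0 [P [/conflatingT[j [u ju]] XP _]]] _] := approxX E.
    have epu : epi (comp p u).
      exact: epi_comp (cokernel_epi ju.2) (cokernel_epi ip.2).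
    have [K' [i' iP]] := ex_short_exact_epi epu.
    have s : conflating setT K' P A0.
      by apply/conflatingT; exists i', (comp p u).
    have rK' : resdim X m K'.
      case: {+}m rA0 => [|m'] rA0; first exact: kX s XP rA0.
      exact: resdimS (resdim_syzygy s XP rA0).
    exists K', P, i', u; split=> //; split=> //; split=> //; first exact: FB.
    by apply: FB; apply: resdim0.
  + by move=> A0 rA0; apply: V1.
- move=> M BM; split; first exact: lappr.
  have [_ [D [A [s rA GD]]]] := appr M.
  have BD := cB _ _ _ s BM (FB _ rA).
  by exists D, A; split=> //; apply: relconf => //; apply: FB.
Qed.

(** In a precover of [M] the term [P] is an extension of [M] by [K], both orthogonal to [X], so [P]
    lies in [W]. *)
Lemma resdim_rperp1_core M :
  W = X `&` rperp_i setT 1 X ->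
  resdim X m M -> rperp_i setT 1 X M -> resdim W m M.
Proof.
move=> Wdef; case: (m) => [|m'] rM MX; first by rewrite /= Wdef.
have [K [P [s XP rK]]] := resdim_precover rM.
exists K, P; split=> //; rewrite Wdef; split=> //.
exact: closed_ext_rperp1 s (resdim_rperp1 rK) MX.
Qed.

Lemma cotorsion_pair_wedge_complete (G' : set C) :
  W = X `&` rperp_i setT 1 X -> rperp_i setT 1 X = rperp setT X ->
  hereditary_complete_cotorsion_pair setT (resdim X m) G' ->
  wedge_complete_in W m (rperp_i setT 1 X).
Proof.
move=> Wdef Xperp [[G'E _] _ cpl] M MX; rewrite (resolvedE m sW).
have G'G N : G' N -> G N by rewrite -G'E; apply: rperp1_resdim_sub.
have [[D [A [s rA GD]]] [D' [A' [s' rA' GD']]]] := cpl M I.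
split.
  exists D, A; split=> //; last by case: (G'G _ GD).
  apply: resdim_rperp1_core => //.
  by apply: closed_ext_rperp1 s _ MX; case: (G'G _ GD).
exists D', A'; split=> //; last by case: (G'G _ GD').
(* [A'] is the quotient of [D'] by [M], so its orthogonality rests on Ext^2(E, M) = 0, supplied by
   [Xperp]. *)
apply: resdim_rperp1_core => //; apply/rperp1P => E XE.
apply: (Ext_vanishes_quotient s').
  by case: (G'G _ GD') => _ /rperp1P; apply.
by rewrite Xperp in MX; case: (MX 2 isT) => _; apply.
Qed.

End FrobeniusPair.

Theorem theorem3p5 (C : abelianCategory) (X W : set C) (m : nat)
    (frobXW : frobenius_pair X W) :
  (hereditary_complete_cotorsion_pair setT X (rperp setT X) ->
   W = X `&` rperp setT X ->
   ((wedge_complete_in W m (rperp setT X) ->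
     hereditary_complete_cotorsion_pair setT (resolved X m)
       (rperp_i setT 1 (resolved W m) `&` rperp setT X)) /\
    ((exists G : set C,
        hereditary_complete_cotorsion_pair setT (resolved X m) G) ->
     wedge_complete_in W m (rperp setT X))) /\
   (forall B : set C,
      left_thick B -> resolved X m `<=` B -> B `<=` finitely_resolved X ->
      wedge_complete_in W m (rperp setT X) ->
      hereditary_complete_cotorsion_pair B (resolved X m)
        (rperp_i setT 1 (resolved W m) `&` rperp setT X `&` B))) /\
  (wedge_complete_in W m (rperp_i setT 1 X) ->
   cotorsion_pair_cut_along (resolved X m)
     (rperp_i setT 1 (resolved W m) `&` rperp_i setT 1 X)
     (finitely_resolved X)).
Proof.
have [[_ _ sX] sW _ _ _] := frobXW.
rewrite (resolvedE m sX) (resolvedE m sW).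
have half : wedge_complete_in W m (rperp_i setT 1 X) ->
    forall N, rperp_i setT 1 X N -> exists K L,
      [/\ conflating setT N K L, resdim W m L
        & rperp_i setT 1 (resdim W m) K].
  by move=> cpl N /cpl[_]; rewrite (resolvedE m sW).
split; last by move=> /half; apply: resdim_cotorsion_pair_cut.
move=> [[Xperp _] _ approxX]; rewrite -Xperp => Wdef.
have appr M : has_approximations setT X (rperp_i setT 1 X) M.
  by rewrite Xperp; apply: approxX.
split; last first.
  by move=> B tB FB _ /half; apply: resdim_cotorsion_pair.
split.
  (* The ambient category is the case [B = setT]. *)
  move=> /half cpl; rewrite -[_ `&` _]setIT.
  by apply: resdim_cotorsion_pair => //; split=> *.
by move=> [G' pG']; apply: cotorsion_pair_wedge_complete pG'.
Qed.
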